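(* Let $L\ge 2$ and $1\le N\le L-1$ be integers. Consider the topological Markov chain of $N$ stones in $L$ holes on a circle, in which at each step exactly one stone moves to the next hole in the positive direction, that hole being empty. Then: (i) The (topological) entropy of this topological Markov chain is $$h=\log\frac{\sin\frac{\pi N}{L}}{\sin\frac{\pi}{L}}.$$ (ii) For the measure of maximal entropy of this chain, the probabilities of the states are given by a determinantal measure whose correlation kernel is the projection onto (any) $N$ consecutive Fourier harmonics (out of $L$). That is, let $S\subset\mathbb{Z}/L\mathbb{Z}$ be the random set of stone positions under the one-time marginal of the measure of maximal entropy, and let $K=(K_{k,l})_{k,l\in\mathbb{Z}/L\mathbb{Z}}$ be the matrix of the orthogonal projection of $\mathbb{C}^L$ onto the span of $v_{r_0},v_{r_0+1},\dots,v_{r_0+N-1}$ for any $r_0\in\mathbb{Z}$. Then for all $n$ and all pairwise distinct $k_1,\dots,k_n\in\mathbb{Z}/L\mathbb{Z}$, $$\mathbb{P}(\{k_1,\dots,k_n\}\subset S)=\det\big(K_{k_a,k_b}\big)_{a,b=1}^n .$$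
   Context: The holes are indexed by $\mathbb{Z}/L\mathbb{Z}$. A state is an $N$-element subset $S\subset\mathbb{Z}/L\mathbb{Z}$ (the holes containing a stone). A transition $S\to S'$ is allowed if and only if $S'=(S\setminus\{k\})\cup\{k+1\}$ for some $k\in S$ with $k+1\notin S$ (addition mod $L$). The topological Markov chain is the shift on sequences of states all of whose consecutive pairs are allowed transitions; its topological entropy is the logarithm of the spectral radius of the $0$-$1$ transition matrix. The measure of maximal entropy is the shift-invariant probability measure whose measure-theoretic entropy equals the topological entropy (Parry measure; it is unique since the chain is irreducible). The Fourier harmonics are $v_r=(e^{-2\pi i k r/L})_{k\in\mathbb{Z}/L\mathbb{Z}}\in\mathbb{C}^L$, $r\in\mathbb{Z}/L\mathbb{Z}$. *)

(* Defs.v *)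
From HB Require Import structures.
From mathcomp Require Import all_boot all_order all_algebra.
From mathcomp Require Import all_classical all_reals all_analysis.
From mathcomp Require Import spectral complex.

Set Implicit Arguments.
Unset Strict Implicit.
Unset Printing Implicit Defensive.

Import Order.TTheory GRing.Theory Num.Theory.
Import numFieldNormedType.Exports.

Local Open Scope classical_set_scope.
Local Open Scope ring_scope.

Section kolmogorov_sinai_entropy.
Context d (T : measurableType d) (R : realType).
Implicit Types (mu : probability T R) (f : T -> T).

(* A finite measurable partition of T is represented by the map sending a
   point to the label of the piece that contains it; pieces may be empty. *)
Definition measurable_partition (I : finType) (xi : T -> I) : Prop :=
  forall i, measurable (xi @^-1` [set i]).

(* Since ln 0 = 0, pieces of measure zero contribute 0. *)
Definition shannon_entropy mu (I : finType) (xi : T -> I) : R :=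
  - \sum_(i : I) fine (mu (xi @^-1` [set i])) *
                 ln (fine (mu (xi @^-1` [set i]))).

(* The labelling map of the join of the partitions f^{-j} xi, 0 <= j < n. *)
Definition iterated_join f (I : finType) (xi : T -> I) (n : nat) (x : T) :
    {ffun 'I_n -> I} :=
  [ffun j : 'I_n => xi (iter j f x)].

Definition partition_entropy mu f (I : finType) (xi : T -> I) : R :=
  limn (fun n : nat => shannon_entropy mu (iterated_join f xi n) / n%:R).

Definition ks_entropy mu f : \bar R :=
  ereal_sup [set h | exists (k : nat) (xi : T -> 'I_k),
    measurable_partition xi /\ h = (partition_entropy mu f xi)%:E].

Definition invariant_measure mu f : Prop :=
  forall A, measurable A -> mu (f @^-1` A) = mu A.

End kolmogorov_sinai_entropy.

Section shift_space.

HB.instance Definition _ (T : finType) := isPointed.Build {set T} finset.set0.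

Definition coordinate_cylinders (A : Type) : set_system (int -> A) :=
  [set C | exists (t : int) (a : A), C = [set x | x t = a]].

(* For a finite (or countable) alphabet A this is the product sigma-algebra. *)
Definition shift_space (A : pointedType) :=
  g_sigma_algebraType (@coordinate_cylinders A).

Definition left_shift (A : Type) (x : int -> A) : int -> A := fun t => x (t + 1).

End shift_space.

Section spectral_radius.
Variable R : realType.

Definition spectral_radius n (A : 'M[R[i]]_n) : R :=
  sup [set Normc.normc a | a in [set a | eigenvalue A a]].

Definition transition_matrix (S : finType) (e : rel S) : 'M[R[i]]_#|S| :=
  \matrix_(i, j) (e (enum_val i) (enum_val j))%:R.

End spectral_radius.

Section stones.
Variables L N : nat.

Definition state := {S : {set 'Z_L} | #|S| == N}.

Definition stone_move (S S' : {set 'Z_L}) : bool :=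
  [exists k in S, (k + 1 \notin S) && (S' == (S :\ k) :|: [set k + 1])%SET].

Definition stones_entropy (R : realType) : R :=
  ln (spectral_radius
    (transition_matrix R (fun S S' : state => stone_move (val S) (val S')))).

Definition trajectories : set (shift_space {set 'Z_L}) :=
  [set x : int -> {set 'Z_L} |
    forall t : int, #|x t| = N /\ stone_move (x t) (x (t + 1))].

(* Probability measures on the chain are the probability measures on the full
   shift that give full mass to the set of trajectories. *)
Definition max_entropy_measure (R : realType)
    (mu : probability (shift_space {set 'Z_L}) R) : Prop :=
  [/\ mu trajectories = 1%E,
      invariant_measure mu (@left_shift _)
    & ks_entropy mu (@left_shift _) = (stones_entropy R)%:E].

Section fourier.
Variable R : realType.

Definition fourier_harmonic (r : int) : 'rV[R[i]]_(Zp_trunc L).+2 :=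
  \row_(k < (Zp_trunc L).+2)
    let t := - (2 * pi * k%:R * r%:~R / L%:R) in
    (cos t +i* sin t)%C.

(* proj_ortho acts on row vectors from the right; the transpose is the matrix
   of the same orthogonal projection acting on column vectors from the left. *)
Definition correlation_kernel (r0 : int) : 'M[R[i]]_((Zp_trunc L).+2) :=
  (proj_ortho (\matrix_(j < N) fourier_harmonic (r0 + j%:Z)))^T.

End fourier.
End stones.

(* Main.v *)
(** Let [w H] be the squared modulus of the Vandermonde determinant of the
    L-th roots of unity indexed by [H]. A Lagrange interpolation identity shows
    that [S |-> sqrt (w (~: S))] is a positive left and right eigenvector of the
    transition matrix, with eigenvalue
    [lam = sin (pi (L - N) / L) / sin (pi / L) = sin (pi N / L) / sin (pi / L)];
    hence [lam] is the spectral radius.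

    For an invariant measure, approximating a finite partition by cylinders and
    using Gibbs' inequality bounds the entropy by the mean of [- ln Q (x 0) (x 1)]
    for every sub-stochastic kernel [Q] positive on the support. Taking for [Q]
    the conditional law of [x 1] given [x 0], entropy [ln lam] forces this law
    to be the Parry kernel of the eigenvector, and a Dirichlet form argument
    along the connected graph of moves then forces the law of [x 0] to be
    proportional to [w (~: S)]. So the empty holes form the determinantal process
    of [L - N] consecutive harmonics, by the Cauchy-Binet formula, and the
    probability that they avoid given points is [det (1 - K')] for the
    corresponding projection [K']. Since [1 - K'] is the projection on the
    remaining [N] harmonics, this is the claim for the stones. *)

Require Import Defs.
From HB Require Import structures.
From mathcomp Require Import fingroup perm.
From mathcomp Require Import all_boot all_order all_algebra.
From mathcomp Require Import all_classical all_reals all_analysis.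
From mathcomp Require Import spectral complex.
From mathcomp Require Import lra ring zify.

Set Implicit Arguments.
Unset Strict Implicit.
Unset Printing Implicit Defensive.

Import Order.TTheory GRing.Theory Num.Theory.

Local Open Scope classical_set_scope.
Local Open Scope ring_scope.

(** * Entropy of finite partitions *)

Lemma ln_leif_subr1 (R : realType) (x : R) : 0 < x -> ln x <= x - 1 ?= iff (x == 1).
Proof.
move=> x0; apply/leifP; case: eqVneq => [->|x1]; first by rewrite ln1 subrr.
rewrite ltrBrDl -{2}(lnK (x0 : x \is Num.pos)) expR_gt1Dx // ln_eq0 //.
Qed.

(** The bound [ln x <= x - 1] at [x = q / p], scaled by [p]. For [p = 0] it degenerates to [0 <= q],
    so the equality case stays correct there. *)
Lemma gibbs_leif (R : realType) (p q : R) : 0 <= p -> 0 <= q -> (0 < p -> 0 < q) ->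
  p * ln q - p * ln p <= q - p ?= iff (p == q).
Proof.
move=> p0 q0 pq; case: (eqVneq p 0) => [->|pN0].
  rewrite !mul0r subr0; split; rewrite ?subr0 ?oppr0 ?addr0 //.
have {}p0 : 0 < p by rewrite lt_neqAle eq_sym pN0.
have {}q0 := pq p0.
have [le1 eq1] := @ln_leif_subr1 R (q / p) (divr_gt0 q0 p0).
have -> : q - p = p * (q / p - 1) by rewrite mulrBr mulr1 mulrC divfK.
rewrite -mulrBr -ln_div //; split; first by rewrite ler_pM2l.
rewrite (inj_eq (mulfI pN0)) eq1 -[in LHS](divff pN0).
by rewrite (inj_eq (mulIf (invr_neq0 pN0))) eq_sym.
Qed.

Lemma gibbs_sum_leif (R : realType) (I : finType) (p q : I -> R) :
  (forall i, 0 <= p i) -> (forall i, 0 <= q i) -> (forall i, 0 < p i -> 0 < q i) ->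
  \sum_i p i * ln (q i) - \sum_i p i * ln (p i) <= \sum_i q i - \sum_i p i
    ?= iff [forall i, p i == q i].
Proof.
move=> p0 q0 pq; rewrite -!sumrB.
exact: leif_sum (fun i _ => gibbs_leif (p0 i) (q0 i) (@pq i)).
Qed.

Section finite_laws.
Context d (T : measurableType d) (R : realType) (mu : probability T R).

Definition law (I : finType) (X : T -> I) (i : I) : R :=
  fine (mu (X @^-1` [set i])).

Lemma law_ge0 (I : finType) (X : T -> I) i : 0 <= law X i.
Proof. exact: fine_ge0. Qed.

Lemma measurable_partition_preimage (I : finType) (X : T -> I) (A : set I) :
  measurable_partition X -> measurable (X @^-1` A).
Proof.
move=> mX; rewrite -[A]image_id -bigcup_imset1 preimage_bigcup.
apply: fin_bigcup_measurable => // i _; exact: mX.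
Qed.

Lemma measurable_partition_comp (I J : finType) (X : T -> I) (phi : I -> J) :
  measurable_partition X -> measurable_partition (phi \o X).
Proof. by move=> mX j; rewrite comp_preimage; exact: measurable_partition_preimage. Qed.

Lemma measurable_partition_pair (I J : finType) (X : T -> I) (Y : T -> J) :
  measurable_partition X -> measurable_partition Y ->
  measurable_partition (fun x => (X x, Y x)).
Proof.
move=> mX mY [i j].
rewrite (_ : _ @^-1` _ = X @^-1` [set i] `&` Y @^-1` [set j]).
  exact: measurableI.
by apply/seteqP; split => x /= [-> ->].
Qed.

Lemma prob_preimage (I : finType) (X : T -> I) (A : pred I) :
  measurable_partition X ->
  fine (mu (X @^-1` [set i | A i])) = \sum_(i | A i) law X i.
Proof.
move=> mX; rewrite sum_fine; last first.
  by move=> i _; exact: fin_num_measure.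
congr fine.
rewrite (_ : [set i | A i] = \bigcup_(i in [set` enum A]) [set i]); last first.
  rewrite bigcup_imset1 image_id; apply/seteqP; split => i /=; by rewrite mem_enum.
rewrite preimage_bigcup measure_fin_bigcup //.
- by rewrite -fsbig_seq ?enum_uniq // big_enum.
- by move=> i j _ _ [x [/= -> ->]].
Qed.

Lemma law_sum1 (I : finType) (X : T -> I) :
  measurable_partition X -> \sum_i law X i = 1.
Proof.
move=> mX; rewrite -(prob_preimage xpredT) //.
rewrite (_ : _ @^-1` _ = setT); last by apply/seteqP; split.
by rewrite probability_setT.
Qed.

Lemma law_comp (I J : finType) (X : T -> I) (phi : I -> J) j :
  measurable_partition X -> law (phi \o X) j = \sum_(i | phi i == j) law X i.
Proof.
move=> mX; rewrite -prob_preimage // /law; congr (fine (mu _)).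
by apply/seteqP; split => x /= /eqP.
Qed.

Lemma law_comp_expect (I J : finType) (X : T -> I) (phi : I -> J) (g : J -> R) :
  measurable_partition X ->
  \sum_j law (phi \o X) j * g j = \sum_i law X i * g (phi i).
Proof.
move=> mX; rewrite [RHS](partition_big phi xpredT) //=; apply: eq_bigr => j _.
rewrite law_comp // mulr_suml; apply: eq_big => i //= /eqP-> //.
Qed.

Lemma law_comp_le (I J : finType) (X : T -> I) (phi : I -> J) i :
  measurable_partition X -> law X i <= law (phi \o X) (phi i).
Proof.
move=> mX; rewrite law_comp // (bigD1 i) //= lerDl; apply: sumr_ge0 => *.
exact: law_ge0.
Qed.

(** Both entropies are means of [- ln] of a mass under the law of [X], and merging pieces only
    increases the masses. *)
Lemma entropy_comp_le (I J : finType) (X : T -> I) (phi : I -> J) :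
  measurable_partition X ->
  shannon_entropy mu (phi \o X) <= shannon_entropy mu X.
Proof.
move=> mX; rewrite /shannon_entropy lerN2.
rewrite (law_comp_expect phi (fun j => ln (law (phi \o X) j)) mX).
apply: ler_sum => i _; have := law_ge0 X i; rewrite le_eqVlt => /predU1P[e|p0].
  by rewrite -/(law X i) -e !mul0r.
rewrite ler_pM2l // ler_ln ?posrE //; first exact: law_comp_le.
exact: lt_le_trans (law_comp_le phi i mX).
Qed.

(** Gibbs' inequality for the joint law against [law X i * q i j]: a chain rule in which the
    conditional entropy of [Y] given [X] is bounded by its cross-entropy against [q]. *)
Lemma entropy_pair_le (I J : finType) (X : T -> I) (Y : T -> J) (q : I -> J -> R) :
  measurable_partition X -> measurable_partition Y ->
  (forall i j, 0 <= q i j) -> (forall i, \sum_j q i j <= 1) ->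
  (forall x, 0 < law (fun x => (X x, Y x)) (X x, Y x) -> 0 < q (X x) (Y x)) ->
  shannon_entropy mu (fun x => (X x, Y x)) <=
  shannon_entropy mu X +
  \sum_ij law (fun x => (X x, Y x)) ij * - ln (q ij.1 ij.2).
Proof.
move=> mX mY q0 q1 qpos; set Z := fun x => (X x, Y x).
have mZ : measurable_partition Z by exact: measurable_partition_pair.
have qpos' ij : 0 < law Z ij -> 0 < q ij.1 ij.2.
  (* A pair of positive mass is attained at some point, so positivity of [q] along points
     suffices. *)
  move=> p0; have [x Zx] : (Z @^-1` [set ij]) !=set0.
    by apply/set0P; apply/eqP => Z0; move: p0; rewrite /law Z0 measure0 ltxx.
  by rewrite -Zx; apply: qpos; rewrite -/Z [(_, _)]Zx.
have Xfst : X = fst \o Z by [].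
have XZ ij : law Z ij <= law X ij.1 by rewrite Xfst law_comp_le.
have := @gibbs_sum_leif R _ (law Z) (fun ij => law X ij.1 * q ij.1 ij.2).
case=> [ij|ij|ij p0|].
- exact: law_ge0.
- by rewrite mulr_ge0 // law_ge0.
- by rewrite mulr_gt0 // ?qpos' // (lt_le_trans p0).
move=> + _; rewrite [X in _ <= _ - X]law_sum1 //.
have s1 : \sum_(ij : I * J) law X ij.1 * q ij.1 ij.2 <= 1.
  rewrite -(pair_bigA _ (fun i j => law X i * q i j)) /= -(law_sum1 mX).
  by apply: ler_sum => i _; rewrite -mulr_sumr ler_piMr // law_ge0.
rewrite -subr_le0 in s1 => /le_trans/(_ s1).
rewrite /shannon_entropy.
have -> : \sum_(i : I) law X i * ln (law X i) =
    \sum_ij law Z ij * ln (law X ij.1).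
  by rewrite {1}Xfst (law_comp_expect fst (fun i => ln (law X i))).
have -> : \sum_ij law Z ij * ln (law X ij.1 * q ij.1 ij.2) =
   \sum_ij law Z ij * ln (law X ij.1) - \sum_ij law Z ij * - ln (q ij.1 ij.2).
  rewrite -sumrB; apply: eq_bigr => ij _.
  have := law_ge0 Z ij; rewrite le_eqVlt => /predU1P[<-|p0].
    by rewrite !mul0r subr0.
  by rewrite lnM ?posrE ?qpos' ?(lt_le_trans p0) // mulrN opprK mulrDr.
rewrite /law /=; lra.
Qed.

End finite_laws.

(** * Entropy of invariant measures of the shift *)

Section shift_entropy.
Import numFieldNormedType.Exports.
Context (I : finType) (R : realType).
Local Notation A := {set I}.
Local Notation X := (shift_space A).
Variable mu : probability X R.
Local Notation shift := (@left_shift A : X -> X).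

Local Notation P B := (fine (mu B)).

Lemma coordinate_measurable (t : int) : measurable_partition (fun x : X => x t).
Proof. by move=> a; apply: sub_sigma_algebra; exists t, a. Qed.

Lemma shift_measurable (B : set X) : measurable B -> measurable (shift @^-1` B).
Proof.
move: B; apply: smallest_sub; last first.
  by move=> _ [t [a ->]]; apply: (coordinate_measurable (t + 1) a).
split.
- by rewrite preimage_set0; exact: measurable0.
- move=> B mB; rewrite setTD preimage_setC; exact: measurableC.
- move=> F mF; rewrite preimage_bigcup; exact: bigcupT_measurable.
Qed.

Lemma iter_shiftE n (x : X) t : iter n shift x t = x (t + n%:Z).
Proof.
elim: n t => [|n IHn] t; first by rewrite addr0.
by rewrite iterS /left_shift IHn -addrA -intS.
Qed.

Lemma iter_shift_partition (J : finType) (Y : X -> J) n :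
  measurable_partition Y -> measurable_partition (Y \o iter n shift).
Proof.
move=> mY; elim: n => [|n IHn] j; first exact: mY.
rewrite (_ : _ @^-1` _ = shift @^-1` ((Y \o iter n shift) @^-1` [set j])).
  by apply: shift_measurable; exact: IHn.
by apply/seteqP; split => x /=; rewrite -iterS iterSr.
Qed.

Lemma law_iter_shift (J : finType) (Y : X -> J) n :
  invariant_measure mu shift -> measurable_partition Y ->
  law mu (Y \o iter n shift) = law mu Y.
Proof.
move=> imu mY; elim: n => [|n IHn]; first by [].
rewrite -[RHS]IHn; apply/funext => j; rewrite /law; congr fine.
rewrite -[RHS]imu; last exact: iter_shift_partition.
by congr (mu _); apply/seteqP; split => x /=; rewrite -iterS iterSr.
Qed.

Definition window m (x : X) : {ffun 'I_(m.*2.+1) -> A} :=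
  [ffun i : 'I_(m.*2.+1) => x (i%:Z - m%:Z)].

Lemma window_measurable m : measurable_partition (window m).
Proof.
move=> w; rewrite (_ : _ @^-1` _ =
    \bigcap_(i in [set: 'I_(m.*2.+1)]) (fun x : X => x (i%:Z - m%:Z)) @^-1` [set w i]).
  by apply: fin_bigcap_measurable => // i _; exact: coordinate_measurable.
apply/seteqP; split => x /=; first by move=> <- i _ /=; rewrite ffunE.
by move=> xw; apply/ffunP => i; rewrite ffunE; exact: xw.
Qed.

Lemma window_eqP m (x y : X) :
  window m x = window m y <-> (forall t, - m%:Z <= t <= m%:Z -> x t = y t).
Proof.
split=> [/ffunP xy t /andP[t1 t2]|xy]; last first.
  apply/ffunP => i; rewrite !ffunE; apply: xy.
  have := ltn_ord i; rewrite ltnS => ?; apply/andP; split; lia.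
have ti : (absz (t + m%:Z)%R < m.*2.+1)%N by lia.
have := xy (Ordinal ti); rewrite !ffunE /= (_ : _ - _ = t) //; lia.
Qed.

(** Turns the assertion that [Z] determines [F] into a map on labels, the form taken by
    [entropy_comp_le] and [law_comp_expect]. Off the range of [Z] an arbitrary value of [F]
    serves. *)
Lemma factor_through (J : Type) (Y : Type) (Z : X -> J) (F : X -> Y) :
  (forall x y, Z x = Z y -> F x = F y) -> exists phi, forall x, F x = phi (Z x).
Proof.
move=> ZF.
exists (fun j => match pselect (exists x, Z x = j) with
  | left e => F (projT1 (cid e)) | right _ => F (fun=> finset.set0) end) => x.
case: pselect => [e|]; last by case; exists x.
by case: (cid e) => y /= /ZF ->.
Qed.

Lemma prob_le (B C : set X) : measurable B -> measurable C -> B `<=` C -> P B <= P C.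
Proof.
move=> mB mC BC; apply: fine_le; rewrite ?fin_num_measure //.
by apply: le_measure => //; rewrite inE.
Qed.

Lemma prob_setU (B C : set X) : measurable B -> measurable C ->
  P (B `|` C) <= P B + P C.
Proof.
move=> mB mC; rewrite -fineD ?fin_num_measure //; apply: fine_le.
- by rewrite fin_num_measure //; exact: measurableU.
- by rewrite fin_numD !fin_num_measure.
- exact: measureU2.
Qed.

Lemma prob_bigcup (J : finType) (F : J -> set X) :
  (forall j, measurable (F j)) -> P (\bigcup_j F j) <= \sum_j P (F j).
Proof.
move=> mF; have -> : [set: J] = [set` enum J].
  by apply/seteqP; split => j //= _; rewrite mem_enum.
rewrite -big_enum /=; elim: (enum J) => [|j s IHs].
  by rewrite set_nil bigcup_set0 measure0 big_nil.
have -> : [set` j :: s] = [set j] `|` [set` s].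
  by apply/seteqP; split => i /=; rewrite in_cons => /predU1P.
rewrite bigcup_setU bigcup_set1 big_cons.
apply: le_trans (prob_setU _ _) _ => //; last by rewrite lerD2l.
by apply: fin_bigcup_measurable => //; exact: finite_seq.
Qed.

(** * Approximation of measurable events by window events *)

Definition sdist (B C : set X) : R := P (B `\` C) + P (C `\` B).

(** Asking for all larger windows, not just one, lets finitely many sets be approximated on a common
    window. *)
Definition approximable (B : set X) : Prop := measurable B /\
  forall e : R, 0 < e ->
  exists m, forall m', (m <= m')%N -> exists D : set {ffun 'I_(m'.*2.+1) -> A},
    sdist B (window m' @^-1` D) <= e.

Lemma sdist_trans (B C D : set X) : measurable B -> measurable C -> measurable D ->
  sdist B D <= sdist B C + sdist C D.
Proof.
have tri (E F G : set X) : measurable E -> measurable F -> measurable G ->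
    P (E `\` G) <= P (E `\` F) + P (F `\` G).
  move=> mE mF mG; apply: le_trans (prob_setU _ _); try exact: measurableD.
  apply: prob_le; try exact: measurableD.
    by apply: measurableU; exact: measurableD.
  by move=> x [Ex Gx]; have [Fx|Fx] := pselect (F x); [right|left].
move=> mB mC mD; rewrite /sdist.
have := tri _ _ _ mB mC mD; have := tri _ _ _ mD mC mB; lra.
Qed.

Lemma sdist_setU (B B' C C' : set X) : measurable B -> measurable C ->
  measurable B' -> measurable C' ->
  sdist (B `|` B') (C `|` C') <= sdist B C + sdist B' C'.
Proof.
have dif (E F G H : set X) : measurable E -> measurable F -> measurable G ->
    measurable H -> P ((E `|` F) `\` (G `|` H)) <= P (E `\` G) + P (F `\` H).
  move=> mE mF mG mH; apply: le_trans (prob_setU _ _); try exact: measurableD.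
  apply: prob_le.
  - by apply: measurableD; exact: measurableU.
  - by apply: measurableU; exact: measurableD.
  - by move=> x [[Ex|Fx] /not_orP[Gx Hx]]; [left|right].
move=> mB mC mB' mC'; rewrite /sdist.
have := dif _ _ _ _ mB mB' mC mC'; have := dif _ _ _ _ mC mC' mB mB'; lra.
Qed.

Lemma window_preimage_measurable m D : measurable (window m @^-1` D).
Proof. by apply: measurable_partition_preimage; exact: window_measurable. Qed.
Local Hint Resolve window_preimage_measurable : core.

Lemma approximable0 : approximable set0.
Proof.
split; first exact: measurable0.
move=> e e0; exists 0%N => m' _; exists set0.
by rewrite /sdist preimage_set0 setD0 measure0 addr0 ltW.
Qed.

Lemma approximableC B : approximable B -> approximable (~` B).
Proof.
move=> [mB aB]; split; first exact: measurableC.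
move=> e /aB[m mD]; exists m => m' /mD[D BD].
exists (~` D); apply: le_trans BD.
by rewrite /sdist preimage_setC !setDE !setCK setIC [_ `&` B]setIC addrC.
Qed.

Lemma approximableU B C : approximable B -> approximable C -> approximable (B `|` C).
Proof.
move=> [mB aB] [mC aC]; split; first exact: measurableU.
move=> e e0; have e20 : 0 < e / 2 by rewrite divr_gt0.
have [m1 m1D] := aB _ e20; have [m2 m2D] := aC _ e20.
exists (maxn m1 m2) => m'; rewrite geq_max => /andP[/m1D[D1 BD1] /m2D[D2 CD2]].
exists (D1 `|` D2); rewrite preimage_setU; apply: le_trans (sdist_setU _ _ _ _) _ => //.
lra.
Qed.

(** Continuity from below replaces the countable union by a finite one at cost [e / 2]; the other
    half pays for approximating the finite union. *)
Lemma approximable_bigcup (F : nat -> set X) :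
  (forall n, approximable (F n)) -> approximable (\bigcup_n F n).
Proof.
move=> aF; have mF n : measurable (F n) by case: (aF n).
have mUF : measurable (\bigcup_n F n) by exact: bigcupT_measurable.
split=> // e e0.
pose G n := \big[setU/set0]_(i < n.+1) F i.
have aG n : approximable (G n).
  by apply: (big_ind approximable) => //; [exact: approximable0|exact: approximableU].
have mG n : measurable (G n) by case: (aG n).
have GF : \bigcup_n G n = \bigcup_n F n by exact: bigcup_bigsetU_bigcup.
have cvgG : P (G n) @[n --> \oo] --> P (\bigcup_n F n).
  apply: fine_cvg; rewrite fineK ?fin_num_measure // -GF.
  apply: nondecreasing_cvg_mu => //; first by rewrite GF.
  apply/nondecreasing_seqP => n; rewrite subsetEset /G.
  by rewrite [X in _ `<=` X]big_ord_recr; exact: subsetUl.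
have e20 : 0 < e / 2 by rewrite divr_gt0.
have [n Gn] : exists n, P (\bigcup_n F n `\` G n) <= e / 2.
  have /cvgrPdist_le/(_ _ e20)[n _ /(_ n (leqnn n))] := cvgG.
  move=> Gn; exists n; apply: le_trans Gn; apply: le_trans (ler_norm _).
  have GsubF : G n `<=` \bigcup_n F n by rewrite -GF; exact: bigcup_sup.
  rewrite measureD // ?ltey_eq ?fin_num_measure // setIidr // fineB ?fin_num_measure //.
have [_ /(_ _ e20)[m mD]] := aG n.
exists m => m' /mD[D GD]; exists D.
apply: le_trans (sdist_trans mUF (mG n) _) _ => //.
rewrite {1}/sdist (_ : G n `\` _ = set0) ?measure0 /=; first lra.
by rewrite setD_eq0 -GF; exact: bigcup_sup.
Qed.

(** Approximable sets form a sigma-algebra, and a coordinate cylinder is itself a window event once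
    the window reaches its time. *)
Lemma measurable_approximable B : measurable B -> approximable B.
Proof.
move: B; apply: smallest_sub.
  split; first exact: approximable0.
    by move=> B aB; rewrite setTD; exact: approximableC.
  exact: approximable_bigcup.
move=> _ [t [a ->]]; split; first exact: coordinate_measurable.
move=> e e0; exists `|t|%N => m tm.
have ti : (absz (t + m%:Z)%R < m.*2.+1)%N by lia.
exists [set w | w (Ordinal ti) = a].
rewrite (_ : window m @^-1` _ = [set x | x t = a]).
  by rewrite /sdist !setDv measure0 addr0 ltW.
apply/seteqP; split => x /=; rewrite ffunE /= (_ : _ - _ = t) //; lia.
Qed.

(** Each piece is approximated to within [e / k] on a common window, and [eta] picks any label whose
    approximation contains the window. A wrong guess then lies in the symmetric difference of some
    piece and its approximation. *)
Lemma partition_approx k (xi : X -> 'I_k) (e : R) :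
  measurable_partition xi -> 0 < e ->
  exists m (eta : {ffun 'I_(m.*2.+1) -> A} -> 'I_k),
    P [set x | eta (window m x) != xi x] <= e.
Proof.
move=> mxi e0; pose i0 := xi (fun=> finset.set0).
have k0 : (0 < k)%N by exact: leq_ltn_trans (ltn_ord i0).
have ek0 : 0 < e / k%:R by rewrite divr_gt0 // ltr0n.
have /choice[M MD] : forall i : 'I_k, exists m, forall m', (m <= m')%N ->
    exists D : set {ffun 'I_(m'.*2.+1) -> A},
    sdist (xi @^-1` [set i]) (window m' @^-1` D) <= e / k%:R.
  by move=> i; have [_] := measurable_approximable (mxi i); apply.
pose m := (\max_i M i)%N; exists m.
have /choice[D Dle] := fun i => MD i m (leq_bigmax i).
pose eta w := odflt i0 [pick i | `[< D i w >]]; exists eta.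
have sub : [set x | eta (window m x) != xi x] `<=` \bigcup_i
    ((xi @^-1` [set i] `\` window m @^-1` D i) `|`
     (window m @^-1` D i `\` xi @^-1` [set i])).
  move=> x /=; rewrite /eta; case: pickP => [i /asboolP Di ixi|noD _].
    by exists i => //; right; split => //= e1; rewrite e1 eqxx in ixi.
  exists (xi x) => //; left; split => //= Dx.
  by have := noD (xi x); rewrite asboolT.
have mi (i : 'I_k) : measurable ((xi @^-1` [set i] `\` window m @^-1` D i) `|`
     (window m @^-1` D i `\` xi @^-1` [set i])).
  by apply: measurableU; apply: measurableD.
apply: le_trans (prob_le _ _ sub) _.
- have mp := measurable_partition_pair (window_measurable (m := m)) mxi.
  exact: (measurable_partition_preimage [set wi | eta wi.1 != wi.2] mp).
- by apply: fin_bigcup_measurable => //; exact: finite_finset.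
apply: le_trans (prob_bigcup mi) _.
apply: (@le_trans _ _ (\sum_(i < k) e / k%:R)).
  apply: ler_sum => i _; apply: le_trans (prob_setU _ _) (Dle i); exact: measurableD.
by rewrite sumr_const card_ord -[_ *+ k]mulr_natr divfK // pnatr_eq0 -lt0n.
Qed.


Lemma expect_le_prob (J : finType) (Y : X -> J) (B : pred J) (g : J -> R) (a b : R) :
  measurable_partition Y -> 0 <= b ->
  (forall j, g j <= a + (if B j then b else 0)) ->
  \sum_j law mu Y j * g j <= a + b * P [set x | B (Y x)].
Proof.
move=> mY b0 gle.
apply: (@le_trans _ _ (\sum_j law mu Y j * (a + (if B j then b else 0)))).
  by apply: ler_sum => j _; rewrite ler_wpM2l ?law_ge0.
under eq_bigr do rewrite mulrDr; rewrite big_split /= -mulr_suml law_sum1 // mul1r.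
rewrite lerD2l -[[set x | _]]/(Y @^-1` [set j | B j]) (prob_preimage mu B mY).
rewrite mulr_sumr [X in _ <= X]big_mkcond /=.
by apply: ler_sum => j _; case: ifP; rewrite ?mulr0 // mulrC.
Qed.

(* The kernel is a mixture of the diagonal with the uniform distribution. *)
Lemma fano_kernel k (e : R) : (0 < k)%N -> 0 < e ->
  exists c (r : 'I_k -> 'I_k -> R), [/\ 0 <= c, forall b a, 0 < r b a,
    forall b, \sum_a r b a <= 1 &
    forall b a, - ln (r b a) <= e + (if b != a then c else 0)].
Proof.
(* The diagonal keeps mass [expR (- e)], so that a correct guess costs at most [e]; the rest, [dl],
   is spread uniformly. *)
move=> k0 e0; pose dl : R := 1 - expR (- e).
have dl0 : 0 < dl by rewrite subr_gt0 -expR0 ltr_expR oppr_lt0.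
have dl1 : dl < 1 by rewrite ltrBlDr ltrDl expR_gt0.
have kR : 0 < k%:R :> R by rewrite ltr0n.
have dlk : 0 < dl / k%:R by rewrite divr_gt0.
exists (- ln (dl / k%:R)), (fun b a => (b == a)%:R * expR (- e) + dl / k%:R).
split.
- rewrite oppr_ge0 ln_le0 // ler_pdivrMr // mul1r (le_trans (ltW dl1)) //.
  by rewrite ler1n.
- by move=> b a; rewrite ltr_wpDl // mulr_ge0 // expR_ge0.
- move=> b; rewrite big_split /= -mulr_suml sumr_const card_ord.
  rewrite -[_ *+ k]mulr_natr divfK ?gt_eqF // (bigD1 b) //= eqxx big1.
    by rewrite addr0 mul1r /dl addrC subrK.
  by move=> a; rewrite eq_sym => /negPf->.
- move=> b a; case: eqVneq => [_|_] /=; last by rewrite mul0r add0r lerDr ltW.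
  rewrite mul1r addr0 lerNl -[X in X <= _]expRK ler_ln ?posrE ?expR_gt0 //.
    by rewrite lerDl ltW.
  by rewrite ltr_wpDl // expR_ge0.
Qed.

(** * Entropy bounded by the cost of a sub-stochastic kernel *)

Section kernel_bound.
Variable Q : A -> A -> R.
Hypothesis imu : invariant_measure mu shift.
Hypothesis Q_ge0 : forall a b, 0 <= Q a b.
Hypothesis Q_sub : forall a, \sum_b Q a b <= 1.
Let step (x : X) : A * A := (x 0, x 1).
Hypothesis Q_gt0 : forall x, 0 < law mu step (step x) -> 0 < Q (x 0) (x 1).
(** The cross-entropy of the next state, given the present one, relative to [Q]. *)
Let h := \sum_ab law mu step ab * - ln (Q ab.1 ab.2).

Lemma step_measurable : measurable_partition step.
Proof. by apply: measurable_partition_pair; exact: coordinate_measurable. Qed.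

Lemma kernel_cost_ge0 : 0 <= h.
Proof.
apply: sumr_ge0 => -[a b] _; rewrite mulr_ge0 ?law_ge0 // oppr_ge0 ln_le0 //=.
by apply: le_trans (Q_sub a); rewrite (bigD1 b) //= lerDl sumr_ge0.
Qed.

Section itinerary.
Context k (xi : X -> 'I_k) (m : nat) (eta : {ffun 'I_(m.*2.+1) -> A} -> 'I_k).
Variables (r : 'I_k -> 'I_k -> R) (e : R).
Hypothesis mxi : measurable_partition xi.
Hypothesis r_gt0 : forall b a, 0 < r b a.
Hypothesis r_sub : forall b, \sum_a r b a <= 1.
Let guess (x : X) := (eta (window m x), xi x).
Hypothesis e_gt0 : 0 < e.
Hypothesis r_cost : \sum_ba law mu guess ba * - ln (r ba.1 ba.2) <= e.

Lemma guess_measurable : measurable_partition guess.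
Proof.
apply: measurable_partition_pair => //.
apply: (measurable_partition_comp (X := window m) eta); exact: window_measurable.
Qed.

(* [Z] is refined one time step at a time: the next state costs at most [h] by
   the kernel [Q], and the next value of [xi] costs at most [e] by the kernel
   [r], because [Z] already determines the guess [eta] of that value. *)
Lemma itinerary_entropy : exists C : R, forall n, exists (J : finType) (Z : X -> J),
  [/\ measurable_partition Z,
      forall x y, Z x = Z y ->
        forall t : int, - m%:Z <= t <= m%:Z + n%:Z -> x t = y t,
      forall x y, Z x = Z y ->
        forall j : nat, (j < n)%N -> xi (iter j shift x) = xi (iter j shift y)
    & shannon_entropy mu Z <= C + n%:R * (h + e)].
Proof.
exists (shannon_entropy mu (window m)); elim=> [|n [J [Z [mZ Zx Zxi HZ]]]].
  exists _, (window m); split=> //.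
  - exact: window_measurable.
  - by move=> x y xy t; rewrite addr0; exact: (window_eqP _ _ _).1.
  - by rewrite mul0r addr0.
pose u (x : X) := x (m%:Z + n.+1%:Z).
have mu_ : measurable_partition u by exact: coordinate_measurable.
pose Z1 x := (Z x, u x).
have mZ1 : measurable_partition Z1 by exact: measurable_partition_pair.
have Z1x x y : Z1 x = Z1 y ->
    forall t : int, - m%:Z <= t <= m%:Z + n.+1%:Z -> x t = y t.
  move=> [/Zx xy uxy] t /andP[t1 t2].
  have [->//|tm] := eqVneq t (m%:Z + n.+1%:Z).
  by apply: xy; rewrite t1 /=; move/eqP in tm; lia.
pose v (x : X) := xi (iter n shift x).
have mv : measurable_partition v by exact: (iter_shift_partition n mxi).
exists _, (fun x => (Z1 x, v x)); split.
- exact: measurable_partition_pair.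
- by move=> x y [zxy uxy _]; apply: Z1x; rewrite /Z1 zxy uxy.
- move=> x y [zxy uxy vxy] j; rewrite ltnS leq_eqVlt => /predU1P[->//|jn].
  exact: Zxi.
have [phi phiE] : exists phi, forall x : X, x (m%:Z + n%:Z) = phi (Z x).
  by apply: factor_through => x y /Zx; apply; apply/andP; split; lia.
have [psi psiE] : exists psi, forall x : X,
    eta (window m (iter n shift x)) = psi (Z1 x).
  apply: factor_through => x y /Z1x xy; congr eta; apply/window_eqP => t /andP[t1 t2].
  by rewrite !iter_shiftE; apply: xy; apply/andP; split; lia.
(* The last recorded state and the next one are [step] seen at time [m + n], so by invariance this
   refinement costs [h] at every stage. *)
have stepE : (fun zu : J * A => (phi zu.1, zu.2)) \o Z1 = step \o iter (m + n) shift.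
  apply/funext => x /=; rewrite -phiE /step !iter_shiftE add0r PoszD /u intS.
  by rewrite [in RHS]addrCA.
have H1 : shannon_entropy mu Z1 <= shannon_entropy mu Z + h.
  have hE : \sum_zu law mu Z1 zu * - ln (Q (phi zu.1) zu.2) = h.
    rewrite -(law_comp_expect mu (fun zu : J * A => (phi zu.1, zu.2))
      (fun ab => - ln (Q ab.1 ab.2)) mZ1) stepE law_iter_shift //.
    exact: step_measurable.
  have := @entropy_pair_le _ _ _ mu _ _ Z u (fun z b => Q (phi z) b) mZ mu_.
  rewrite hE; apply=> // x p0.
  have stepx : step (iter (m + n) shift x) = (phi (Z x), u x).
    by rewrite -[LHS]/((step \o iter (m + n) shift) x) -stepE.
  have := @Q_gt0 (iter (m + n) shift x); rewrite stepx.
  have [-> ->] : iter (m + n) shift x 0 = phi (Z x) /\ iter (m + n) shift x 1 = u x.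
    by case: stepx.
  apply; apply: lt_le_trans p0 _.
  have := law_comp_le mu (fun zu : J * A => (phi zu.1, zu.2)) (Z1 x) mZ1.
  by rewrite stepE law_iter_shift //; exact: step_measurable.
have H2 : shannon_entropy mu (fun x => (Z1 x, v x)) <= shannon_entropy mu Z1 + e.
  have mZ2 := measurable_partition_pair mZ1 mv.
  have := @entropy_pair_le _ _ _ mu _ _ Z1 v (fun z b => r (psi z) b) mZ1 mv.
  move=> H; apply: le_trans (H _ _ _) _ => //; first by move=> *; exact: ltW.
  rewrite lerD2l; apply: le_trans r_cost.
  rewrite -(law_comp_expect mu (fun zv : (J * A) * 'I_k => (psi zv.1, zv.2))
      (fun ba => - ln (r ba.1 ba.2)) mZ2).
  rewrite (_ : _ \o _ = guess \o iter n shift); last first.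
    by apply/funext => x /=; rewrite -psiE.
  by rewrite law_iter_shift //; exact: guess_measurable.
rewrite -natr1 mulrDl mul1r; lra.
Qed.

(** The itinerary determines the iterated join, whose entropy is therefore at most
    [C + n * (h + e)]. After division by [n], the second [e] absorbs [C / n]. *)
Lemma partition_entropy_le_cost : partition_entropy mu shift xi <= h + e + e.
Proof.
have [C HC] := itinerary_entropy.
have ub n : shannon_entropy mu (iterated_join shift xi n) <= C + n%:R * (h + e).
  have [J [Z [mZ _ Zxi HZ]]] := HC n.
  have [phi phiE] : exists phi, forall x, iterated_join shift xi n x = phi (Z x).
    apply: factor_through => x y /Zxi xy; apply/ffunP => j; rewrite !ffunE.
    exact: xy.
  rewrite (_ : iterated_join _ _ _ = phi \o Z); last exact/funext.
  exact: le_trans (entropy_comp_le mu phi mZ) HZ.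
rewrite /partition_entropy; set w := fun n => _.
(* [limn] of a divergent sequence is [0], so convergence need not be shown. *)
have [cw|dw] := pselect (cvgn w); last first.
  have -> : limn w = 0.
    by apply: getPN => l wl; apply: dw; apply/cvg_ex; exists l.
  by rewrite !addr_ge0 ?kernel_cost_ge0 // ltW.
apply: limr_le => //; near=> n.
have n0 : (0 : R) < n%:R by rewrite ltr0n; near: n; exact: nbhs_infty_gt.
rewrite /w ler_pdivrMr //; apply: le_trans (ub n) _.
rewrite [n%:R * _]mulrC [(h + e + e) * _]mulrDl addrC lerD2l -ler_pdivrMl //.
by rewrite mulrC; near: n; exact: nbhs_infty_ger.
Unshelve. all: by end_near. Qed.

End itinerary.
(** Of the tolerance [e], a quarter pays for correct guesses under the kernel of [fano_kernel], a
    quarter for wrong ones, and [partition_entropy_le_cost] spends the remaining half. *)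
Lemma ks_entropy_le_cost : (ks_entropy mu shift <= h%:E)%E.
Proof.
apply: ub_ereal_sup => _ [k [xi [mxi ->]]]; rewrite lee_fin.
apply/ler_addgt0Pr => e e0.
have k0 : (0 < k)%N by exact: leq_ltn_trans (ltn_ord (xi (fun=> finset.set0))).
have e20 : 0 < e / 2 by rewrite divr_gt0.
have e40 : 0 < e / 2 / 2 by rewrite divr_gt0.
have [c [r [c0 r0 r1 rc]]] := fano_kernel k0 e40.
(* The divisor is [c + 1] because [c] may vanish. *)
have c10 : 0 < c + 1 by rewrite ltr_wpDl.
have [m [eta etaP]] := partition_approx mxi (divr_gt0 e40 c10).
have := @partition_entropy_le_cost k xi m eta r (e / 2) mxi r0 r1 e20.
rewrite -addrA -splitr; apply.
apply: le_trans (expect_le_prob _ c0 (fun j => rc j.1 j.2)) _.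
  exact: guess_measurable.
rewrite [X in _ <= X]splitr lerD2l.
apply: (@le_trans _ _ ((c + 1) * (e / 2 / 2 / (c + 1)))).
  by apply: ler_pM => //; [exact: fine_ge0|rewrite lerDl].
by rewrite mulrC divfK ?gt_eqF.
Qed.

End kernel_bound.

End shift_entropy.

(** * Spectral radius *)

Section interpolation.
Variable F : fieldType.

(** Compare top coefficients in the interpolation formula: the unnormalised basis polynomials [l x]
    are monic of degree [(size s).-1]. *)
Lemma lagrange_top_coef (s : seq F) (p : {poly F}) :
  uniq s -> (size p <= size s)%N ->
  p`_(size s).-1 = \sum_(x <- s) p.[x] / \prod_(y <- s | y != x) (x - y).
Proof.
move=> us sp; pose l x := \prod_(y <- s | y != x) ('X - y%:P).
have lE x y : (l x).[y] = \prod_(z <- s | z != x) (y - z).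
  by rewrite horner_prod; apply: eq_bigr => z _; rewrite hornerXsubC.
have size_l x : x \in s -> size (l x) = size s.
  move=> xs; rewrite /l -big_filter size_prod_XsubC -rem_filter // size_rem //.
  by rewrite prednK //; case: (s) xs.
have l0 x y : y \in s -> y != x -> (l x).[y] = 0.
  by move=> ys yx; rewrite lE -big_filter (big_rem y) /= ?subrr ?mul0r // mem_filter yx.
have lN0 x : (l x).[x] != 0.
  rewrite lE prodf_seq_neq0; apply/allP => y _; apply/implyP => yx.
  by rewrite subr_eq0 eq_sym.
pose q := p - \sum_(x <- s) (p.[x] / (l x).[x]) *: l x.
have q0 : q = 0.
  apply: (@roots_geq_poly_eq0 _ _ s) => //; last first.
    rewrite (leq_trans (size_polyD _ _)) // geq_max sp size_polyN /=.
    rewrite big_seq; apply: (big_ind (fun r : {poly F} => (size r <= size s)%N)).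
    - by rewrite size_poly0.
    - by move=> a b ha hb; rewrite (leq_trans (size_polyD _ _)) // geq_max ha.
    - by move=> x /size_l <-; exact: size_scale_leq.
  apply/allP => y ys; apply/rootP; rewrite /q !hornerE horner_sum (big_rem y) //=.
  rewrite hornerZ divfK // big_seq big1 ?addr0 ?subrr // => x.
  rewrite mem_rem_uniq // => /andP[xy xs].
  by rewrite hornerZ (l0 x y) ?mulr0 // eq_sym.
rewrite [in LHS](subr0_eq q0) coef_sum big_seq [RHS]big_seq.
apply: eq_bigr => x xs; rewrite coefZ -lE -(size_l x xs) -lead_coefE.
rewrite (monicP _) ?mulr1 //; exact: monic_prod_XsubC.
Qed.

(* Lagrange interpolation of [\prod_b (t 'X - u b)] at the nodes [0] and [u a]. *)
Lemma sum_prod_dilation (T : finType) (H : {set T}) (u : T -> F) (t : F) :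
  {in H &, injective u} -> (forall a, u a != 0) -> t != 0 ->
  (\sum_(a in H) \prod_(b in H :\ a) ((t * u a - u b) / (u a - u b))) * (t - 1)
  = t ^+ #|H| - 1.
Proof.
move=> uinj u0 t0.
pose p := \prod_(b in H) (t *: 'X - (u b)%:P).
have pE x : p.[x] = \prod_(b in H) (t * x - u b).
  by rewrite horner_prod; apply: eq_bigr => b _; rewrite !hornerE.
pose q := \prod_(c <- [seq u b / t | b <- enum H]) ('X - c%:P).
have qmonic : q \is monic by exact: monic_prod_XsubC.
have size_q : size q = #|H|.+1 by rewrite size_prod_XsubC size_map -cardE.
have p_scale : p = t ^+ #|H| *: q.
  rewrite /q big_map big_enum /= -prodr_const -scaler_prod; apply: eq_bigr => b _.
  by rewrite scalerBr -[t *: (_ / _)%:P]mul_polyC -polyCM mulrC divfK.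
pose s := 0 :: [seq u a | a <- enum H].
have us : uniq s.
  rewrite /= map_inj_in_uniq ?enum_uniq; last first.
    by move=> a b; rewrite !mem_enum; exact: uinj.
  by rewrite andbT; apply/mapP => -[a _ /esym/eqP]; apply/negP.
have ss : size s = #|H|.+1 by rewrite /= size_map cardE.
have sp : (size p <= size s)%N by rewrite ss -size_q p_scale size_scale_leq.
have := lagrange_top_coef us sp; rewrite ss /=.
have -> : p`_#|H| = t ^+ #|H|.
  rewrite p_scale coefZ -[X in q`_X]/(#|H|.+1.-1) -size_q -lead_coefE.
  by rewrite (monicP qmonic) mulr1.
move=> ->.
have p0 : p.[0] != 0.
  by rewrite pE; apply/prodf_neq0 => b _; rewrite mulr0 sub0r oppr_eq0.
(* The node [0] contributes [1]: [p.[0]] and its denominator are both the product of the [- u b]. *)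
have -> : \sum_(x <- s) p.[x] / \prod_(y <- s | y != x) (x - y) =
    1 + \sum_(a in H) p.[u a] / (u a * \prod_(b in H :\ a) (u a - u b)).
  rewrite big_cons; congr (_ + _).
    rewrite big_cons eqxx big_map big_enum_cond /= -[RHS](divff p0); congr (_ / _).
    rewrite pE; apply: eq_big => [b|b _]; first by rewrite u0 andbT.
    by rewrite mulr0.
  rewrite big_map big_enum /=; apply: eq_bigr => a aH; congr (_ / _).
  rewrite big_cons eq_sym u0 subr0; congr (_ * _).
  rewrite big_map big_enum_cond /=; apply: eq_bigl => b.
  rewrite !inE; case bH: (b \in H); rewrite ?andbF ?andbT //=.
  by apply/negb_inj; rewrite !negbK; apply/eqP/eqP => [/uinj->|->].
rewrite [1 + _]addrC addrK mulr_suml; apply: eq_bigr => a aH.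
have -> : p.[u a] = u a * ((t - 1) * \prod_(b in H :\ a) (t * u a - u b)).
  rewrite pE (bigD1 a) //= mulrA; congr (_ * _); first by ring.
  by apply: eq_bigl => b; rewrite !inE andbC.
by rewrite -mulf_div divff ?u0 // mul1r prodf_div mulrC mulrA.
Qed.

End interpolation.

(** * Phases on the unit circle *)

Section circle.
Variable R : realType.
Local Notation C := R[i].
Local Open Scope complex_scope.

Definition cis (t : R) : C := cos t +i* sin t.

Lemma cisD (s t : R) : cis (s + t) = cis s * cis t.
Proof. by rewrite /cis cosD sinD; apply/eqP; rewrite eq_complex /= eqxx addrC eqxx. Qed.

Lemma cis0 : cis 0 = 1.
Proof. by rewrite /cis cos0 sin0. Qed.

Lemma cisMn (t : R) n : cis (t *+ n) = cis t ^+ n.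
Proof. by elim: n => [|n IHn]; rewrite ?cis0 // mulrS cisD IHn exprS. Qed.

Lemma cisN (t : R) : cis (- t) = (cis t)^*%C.
Proof. by rewrite /cis cosN sinN. Qed.

Lemma normc_ge0 (z : C) : 0 <= Normc.normc z.
Proof. by case: z => a b; exact: sqrtr_ge0. Qed.

Lemma normc_cis (t : R) : Normc.normc (cis t) = 1.
Proof. by rewrite /= cos2Dsin2 sqrtr1. Qed.

Lemma cis_neq0 (t : R) : cis t != 0.
Proof.
apply/eqP => c0; have := normc_cis t; rewrite c0 Normc.normc0 => /eqP.
by rewrite eq_sym oner_eq0.
Qed.

Lemma cisNV (t : R) : cis (- t) = (cis t)^-1.
Proof.
by apply: (mulIf (cis_neq0 t)); rewrite mulVf ?cis_neq0 // -cisD addNr cis0.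
Qed.

Lemma cisB_conj (t : R) : cis t - cis (- t) = (2 * sin t)%:C * 'i%C.
Proof.
rewrite /cis cosN sinN; apply/eqP; rewrite eq_complex /=.
by apply/andP; split; apply/eqP; ring.
Qed.

Lemma cisB (s t : R) : cis s - cis t = cis ((s + t) / 2) * ((2 * sin ((s - t) / 2))%:C * 'i%C).
Proof.
by rewrite -cisB_conj mulrBr -!cisD; congr (cis _ - cis _); field.
Qed.

Lemma cis_2pi : cis (2 * pi) = 1.
Proof. by rewrite -[2 * pi]add0r mulrC mulr_natr /cis cosD2pi sinD2pi cos0 sin0. Qed.

Lemma i_neq0 : 'i%C != 0 :> C.
Proof. by rewrite eq_complex /= oner_eq0 andbF. Qed.

(** This is [sum_prod_dilation] at [t = cis phi ^+ 2]. Each factor gives up one phase [cis phi], and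
    [t - 1] is [cis phi] times [2 i sin phi]; once the phases cancel, only real sines remain. *)
Lemma hop_sum (T : finType) (H : {set T}) (u : T -> C) (rho : T -> T -> R) (phi : R) :
  {in H &, injective u} -> (forall a, u a != 0) -> sin phi != 0 ->
  {in H &, forall a b, a != b ->
     cis phi ^+ 2 * u a - u b = cis phi * (rho a b)%:C * (u a - u b)} ->
  \sum_(a in H) \prod_(b in H :\ a) rho a b = sin (phi *+ #|H|) / sin phi.
Proof.
move=> uinj u0 sphi urho.
have z0 : cis phi != 0 := cis_neq0 phi.
have i0 := i_neq0.
have two (t : R) : cis t ^+ 2 - 1 = cis t * ((2 * sin t)%:C * 'i%C).
  by rewrite -cisB_conj cisNV mulrBr divff ?cis_neq0.
have := sum_prod_dilation uinj u0 (expf_neq0 2 z0).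
have -> : cis phi ^+ 2 ^+ #|H| = cis (phi *+ #|H|) ^+ 2 by rewrite cisMn exprAC.
rewrite (two phi) (two (phi *+ #|H|)).
have -> : \sum_(a in H) \prod_(b in H :\ a) ((cis phi ^+ 2 * u a - u b) / (u a - u b))
   = cis phi ^+ #|H|.-1 * (\sum_(a in H) \prod_(b in H :\ a) rho a b)%:C.
  rewrite rmorph_sum mulr_sumr; apply: eq_bigr => a aH; rewrite rmorph_prod /=.
  rewrite (cardsD1 a) aH add1n /= -prodr_const -big_split; apply: eq_bigr => b.
  rewrite !inE => /andP[ba bH]; rewrite urho 1?eq_sym // mulfK //.
  by rewrite subr_eq0; apply: contra ba => /eqP/uinj->.
(* The empty set is treated apart because the exponent [#|H|.-1] is truncated there. *)
case: (posnP #|H|) => [/cards0_eq->|H0].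
  by rewrite big_set0 cards0 mulr0n sin0 mul0r.
rewrite cisMn -{2}(prednK H0) exprSr -!mulrA => /(mulfI (expf_neq0 _ z0)).
rewrite mulrCA => /(mulfI z0); rewrite !mulrA => /(mulIf i0).
rewrite -rmorphM => /complexI; rewrite !mulrA [_ * 2]mulrC -mulrA.
move=> /(mulfI _) <-; rewrite ?pnatr_eq0 // mulfK //.
Qed.

(** * Chords between roots of unity and the hopping identity *)

Section roots_of_unity.
Variable L : nat.
Hypothesis L_gt1 : (1 < L)%N.

Let L_neq0 : L%:R != 0 :> R.
Proof. by rewrite pnatr_eq0; case: L L_gt1. Qed.

(** The sign is that of [fourier_harmonic], so that raising the frequency by one multiplies a
    harmonic by [zeta]. *)
Definition zeta (k : 'Z_L) : C := cis (- (2 * pi / L%:R) *+ k).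

Lemma sin_pi_gt0 (m : nat) : (0 < m < L)%N -> 0 < sin (pi * m%:R / L%:R) :> R.
Proof.
move=> /andP[m0 mL]; have L0 : 0 < L%:R :> R by rewrite ltr0n (ltn_trans _ L_gt1).
apply: sin_gt0_pi; apply/andP; split.
  by rewrite divr_gt0 // mulr_gt0 ?pi_gt0 ?ltr0n.
by rewrite ltr_pdivrMr // ltr_pM2l ?pi_gt0 // ltr_nat.
Qed.

Lemma cis_root (m : nat) : cis (- (2 * pi / L%:R) *+ m) ^+ L = 1.
Proof.
rewrite -cisMn mulrnAC -[_ *+ L]mulr_natr mulNr divfK //.
by rewrite mulNrn cisN cisMn cis_2pi expr1n conjc1.
Qed.

Lemma zetaD1 (k : 'Z_L) : zeta (k + 1) = cis (- (2 * pi / L%:R)) * zeta k.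
Proof.
have w1 := cis_root 1; rewrite mulr1n in w1.
rewrite /zeta !cisMn -exprS -[in RHS](expr_mod _ w1) /= modnDmr addn1 /=.
by congr (_ ^+ (_ %% _)); rewrite Zp_cast.
Qed.

Lemma zeta_neq0 k : zeta k != 0. Proof. exact: cis_neq0. Qed.

Lemma zetaB (i j : nat) :
  cis (- (2 * pi / L%:R) *+ i) - cis (- (2 * pi / L%:R) *+ j) =
  cis (- (pi / L%:R)) ^+ (i + j) * ((2 * sin (pi / L%:R * (j%:R - i%:R)))%:C * 'i%C).
Proof.
rewrite cisB -cisMn -mulrA; move: (pi / _) => t.
rewrite -(mulr_natr (- (2 * t)) i) -(mulr_natr (- (2 * t)) j).
rewrite -(mulr_natr (- t) (i + j)) natrD.
move: (i%:R) (j%:R) => x y.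
by congr (cis _ * ((2 * sin _)%:C * _)); field.
Qed.

Lemma sin_sub_gt0 (i j : nat) : (i < j < i + L)%N ->
  0 < sin (pi / L%:R * (j%:R - i%:R)) :> R.
Proof.
move=> /andP[ij jL]; rewrite -natrB 1?ltnW // mulrAC sin_pi_gt0 //.
by rewrite subn_gt0 ij ltn_subLR // ltnW.
Qed.

Lemma zeta_ord (k : 'Z_L) : (k < L)%N.
Proof. by rewrite -[X in (_ < X)%N](Zp_cast L_gt1). Qed.

Lemma zeta_inj : injective zeta.
Proof.
have lt_neq (i j : 'Z_L) : (i < j)%N -> zeta i != zeta j.
  move=> ij; rewrite -subr_eq0 zetaB; apply: mulf_neq0.
    by rewrite expf_neq0 // cis_neq0.
  rewrite mulf_neq0 ?i_neq0 // fmorph_eq0 mulf_neq0 ?pnatr_eq0 // gt_eqF //.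
  by rewrite sin_sub_gt0 // ij (leq_trans (zeta_ord j)) // leq_addl.
move=> i j /eqP; apply: contraTeq; rewrite neq_ltn => /orP[] /lt_neq //.
by rewrite eq_sym.
Qed.

(** Chords are proportional to sines of half-angles. The successor [i.+1] is not reduced modulo [L]:
    at [i = L - 1] reduction could flip the sign of the numerator. *)
Definition hop_ratio (i j : 'Z_L) : R :=
  sin (pi / L%:R * (j%:R - (i.+1)%:R)) / sin (pi / L%:R * (j%:R - i%:R)).

Lemma sin_sub_neq0 (i j : 'Z_L) : i != j -> sin (pi / L%:R * (j%:R - i%:R)) != 0 :> R.
Proof.
rewrite neq_ltn => /orP[ij|ij]; last rewrite -opprB mulrN sinN oppr_eq0.
  by rewrite gt_eqF // sin_sub_gt0 // ij (leq_trans (zeta_ord j)) // leq_addl.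
by rewrite gt_eqF // sin_sub_gt0 // ij (leq_trans (zeta_ord i)) // leq_addl.
Qed.

Lemma hop_ratio_ge0 (i j : 'Z_L) : i != j -> 0 <= hop_ratio i j.
Proof.
have sin_ge0' (m n : nat) : (m <= n <= m + L)%N ->
    0 <= sin (pi / L%:R * (n%:R - m%:R)) :> R.
  move=> /andP[]; rewrite leq_eqVlt => /predU1P[->|mn].
    by rewrite subrr mulr0 sin0.
  rewrite leq_eqVlt => /predU1P[->|nL]; last by rewrite ltW // sin_sub_gt0 ?mn.
  by rewrite natrD addrAC subrr add0r divfK // sinpi.
have iL := zeta_ord i; have jL := zeta_ord j.
rewrite /hop_ratio; case: (ltngtP i j) => [ij _|ij _|/val_inj->]; last by rewrite eqxx.
  by rewrite divr_ge0 // sin_ge0' //; lia.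
rewrite -opprB -[X in _ / sin (_ * X)]opprB !mulrN !sinN invrN mulrNN.
by rewrite divr_ge0 // sin_ge0' //; lia.
Qed.

Lemma zeta_hop (i j : 'Z_L) : i != j ->
  zeta (i + 1) - zeta j =
  cis (- (pi / L%:R)) * (hop_ratio i j)%:C * (zeta i - zeta j).
Proof.
move=> ij; rewrite zetaD1 /zeta -[cis _ * _]cisD -mulrS !zetaB addSn exprS.
rewrite -[LHS]mulrA -[RHS]mulrA; congr (_ * _); rewrite [RHS]mulrCA; congr (_ * _).
rewrite mulrA -rmorphM; congr (_%:C * _).
by rewrite /hop_ratio mulrCA divfK // sin_sub_neq0.
Qed.

Definition chord (i j : 'Z_L) : R := Normc.normc (zeta i - zeta j).

Lemma chord_sym i j : chord i j = chord j i.
Proof. by rewrite /chord -normcN opprB. Qed.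

Lemma chord_ii i : chord i i = 0.
Proof. by rewrite /chord subrr Normc.normc0. Qed.

Lemma chord_gt0 i j : i != j -> 0 < chord i j.
Proof.
move=> ij; rewrite lt_neqAle eq_sym; apply/andP; split; last first.
  by rewrite -ler0c -[_%:C]/(`|zeta i - zeta j|).
by apply: contra ij => /eqP/Normc.eq0_normc/eqP; rewrite subr_eq0 => /eqP/zeta_inj->.
Qed.

Lemma chord_hop i j : i != j -> chord (i + 1) j = hop_ratio i j * chord i j.
Proof.
move=> ij; rewrite /chord zeta_hop // !Normc.normcM normc_cis mul1r; congr (_ * _).
by rewrite /= expr0n addr0 sqrtr_sqr ger0_norm // hop_ratio_ge0.
Qed.

Lemma chord_hop' i j : i != j -> chord (i - 1) j = hop_ratio j i * chord i j.
Proof.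
move=> ij; rewrite (chord_sym i) -chord_hop 1?eq_sym // [RHS]chord_sym /chord.
have -> : zeta i = cis (- (2 * pi / L%:R)) * zeta (i - 1) by rewrite -zetaD1 subrK.
by rewrite zetaD1 -mulrBr Normc.normcM normc_cis mul1r.
Qed.

(** An instance of [hop_sum] with angle [- pi / L] for [c = 1] and [pi / L] for [c = -1]; the
    quotient of sines is even in the angle. *)
Lemma sum_hop (H : {set 'Z_L}) (c : 'Z_L) : c = 1 \/ c = -1 ->
  \sum_(a in H) \prod_(b in H :\ a) (chord (a + c) b / chord a b) =
  sin (pi * #|H|%:R / L%:R) / sin (pi / L%:R).
Proof.
have sL : sin (pi / L%:R) != 0 :> R.
  have := @sin_pi_gt0 1; rewrite mulr1 => /(_ _)/gt_eqF-> //.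
have arg : pi * #|H|%:R / L%:R = pi / L%:R *+ #|H| :> R.
  by rewrite -(mulr_natr (pi / L%:R)) mulrAC.
have w2 : cis (- (pi / L%:R)) ^+ 2 = cis (- (2 * pi / L%:R)).
  by rewrite -cisMn mulNrn -mulrA mulr_natl.
case=> ->.
  transitivity (\sum_(a in H) \prod_(b in H :\ a) hop_ratio a b).
    apply: eq_bigr => a _; apply: eq_bigr => b; rewrite !inE => /andP[ba _].
    by rewrite chord_hop 1?eq_sym // mulfK // gt_eqF // chord_gt0 // eq_sym.
  rewrite (@hop_sum _ H zeta _ (- (pi / L%:R))).
  - by rewrite mulNrn !sinN invrN mulrNN -arg.
  - by move=> a b _ _; exact: zeta_inj.
  - exact: zeta_neq0.
  - by rewrite sinN oppr_eq0.
  - by move=> a b _ _ ab; rewrite w2 -zetaD1 zeta_hop.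
transitivity (\sum_(a in H) \prod_(b in H :\ a) hop_ratio b a).
  apply: eq_bigr => a _; apply: eq_bigr => b; rewrite !inE => /andP[ba _].
  by rewrite chord_hop' 1?eq_sym // mulfK // gt_eqF // chord_gt0 // eq_sym.
rewrite (@hop_sum _ H zeta (fun a b => hop_ratio b a) (pi / L%:R)).
- by rewrite -arg.
- by move=> a b _ _; exact: zeta_inj.
- exact: zeta_neq0.
- by [].
- move=> a b _ _ ab; have := @zeta_hop b a; rewrite eq_sym zetaD1 -w2 => /(_ ab).
  move: (zeta a) (zeta b) => u v e; rewrite -[pi / _]opprK cisNV exprVn.
  have z0 := cis_neq0 (- (pi / L%:R)).
  apply: (mulfI (expf_neq0 2 z0)).
  rewrite mulrBr mulVKf ?expf_neq0 // -opprB e.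
  move: (cis _) z0 (_%:C) => z z0 r; by field.
Qed.

(** Over ordered pairs every chord occurs twice, whence the square of the Vandermonde modulus. *)
Definition weight (H : {set 'Z_L}) : R := \prod_(i in H) \prod_(j in H :\ i) chord i j.

Lemma weight_gt0 H : 0 < weight H.
Proof.
apply: prodr_gt0 => i _; apply: prodr_gt0 => j; rewrite !inE => /andP[ji _].
by rewrite chord_gt0 // eq_sym.
Qed.

Lemma weight_setU1 h (G : {set 'Z_L}) : h \notin G ->
  weight (h |: G) = weight G * (\prod_(j in G) chord h j) ^+ 2.
Proof.
move=> hG; rewrite /weight big_setU1 //= setU1K // expr2 mulrCA; congr (_ * _).
rewrite -big_split /=; apply: eq_bigr => i iG.
have hi : h != i by apply: contraNneq hG => ->.
rewrite (_ : (h |: G) :\ i = h |: (G :\ i)); last first.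
  apply/setP => x; rewrite !inE andb_orr; congr (_ || _).
  by case: (eqVneq x h) => [->|]; rewrite ?andbF // hi.
by rewrite big_setU1 ?inE ?negb_and ?hG ?orbT //= mulrC chord_sym.
Qed.

(* Up to a constant, [hole_psi H] is the modulus of the Slater (Vandermonde)
   determinant of consecutive Fourier harmonics at the points of [H]; it will be
   applied to the set of empty holes rather than to the set of stones. *)
Definition hole_psi (H : {set 'Z_L}) : R := Num.sqrt (weight H).

Lemma hole_psi_gt0 H : 0 < hole_psi H.
Proof. by rewrite sqrtr_gt0 weight_gt0. Qed.

Lemma sqr_hole_psi H : hole_psi H ^+ 2 = weight H.
Proof. by rewrite sqr_sqrtr // ltW // weight_gt0. Qed.

Lemma hole_psi_setU1 h (G : {set 'Z_L}) : h \notin G ->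
  hole_psi (h |: G) = hole_psi G * \prod_(j in G) chord h j.
Proof.
move=> hG; rewrite /hole_psi weight_setU1 // sqrtrM ?ltW ?weight_gt0 // sqrtr_sqr.
rewrite ger0_norm //; apply: prodr_ge0 => j jG; rewrite ltW // chord_gt0 //.
by apply: contraNneq hG => ->.
Qed.

Definition growth (m : nat) : R := sin (pi * m%:R / L%:R) / sin (pi / L%:R).

(** Symmetry between stones and holes, from [sin (pi - x) = sin x]. *)
Lemma growthC m : (m <= L)%N -> growth (L - m) = growth m.
Proof.
move=> mL; rewrite /growth natrB // mulrBr mulrBl mulfK //.
by rewrite addrC sinDpi sinN opprK.
Qed.

Lemma growth_gt0 m : (0 < m < L)%N -> 0 < growth m.
Proof.
by move=> m0; rewrite divr_gt0 ?sin_pi_gt0 // -[pi]mulr1 -[1]/(1%:R) sin_pi_gt0.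
Qed.

(** A move of [h] to [h + c] multiplies [hole_psi] by the product of chord ratios summed in
    [sum_hop]. A blocked move contributes zero there, because the chord from [h + c] to itself
    vanishes; so exclusion is automatic. *)
Lemma sum_hole_psi_hop (H : {set 'Z_L}) (c : 'Z_L) : c = 1 \/ c = -1 ->
  \sum_(h in H | h + c \notin H) hole_psi ((h + c) |: (H :\ h)) =
  growth #|H| * hole_psi H.
Proof.
move=> c1; have c0 : c != 0 by case: c1 => ->; rewrite ?oppr_eq0 oner_eq0.
rewrite mulrC -[growth _](sum_hop H c1) mulr_sumr [LHS]big_mkcondr /=; apply: eq_bigr => h hH.
have hc : h + c != h by rewrite -subr_eq0 addrAC subrr add0r.
have chN0 b : b \in H :\ h -> chord h b != 0.
  by rewrite !inE => /andP[bh _]; rewrite gt_eqF // chord_gt0 // eq_sym.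
case: ifPn => [hcH|]; last first.
  rewrite negbK => hcH; rewrite (bigD1 (h + c)) ?inE ?hc //=.
  by rewrite chord_ii !mul0r mulr0.
rewrite hole_psi_setU1; last by rewrite !inE negb_and hcH orbT.
rewrite -[in RHS](finset.setD1K hH) hole_psi_setU1 ?setD11 // setU1K ?setD11 //.
rewrite -mulrA; congr (_ * _); rewrite -big_split /=; apply: eq_bigr => b bH.
by rewrite mulrC divfK // chN0.
Qed.

End roots_of_unity.

End circle.

(** * Moves of stones: eigenvector and connectivity *)

Section stone_moves.
Variable L : nat.
Hypothesis L_gt1 : (1 < L)%N.
Implicit Types S : {set 'Z_L}.

Lemma Zp_add1_neq (k : 'Z_L) : k + 1 != k.
Proof. by rewrite -subr_eq0 addrAC subrr add0r oner_eq0. Qed.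

Lemma Zp_pred (k : 'Z_L) : (0 < k)%N -> nat_of_ord (k - 1) = k.-1.
Proof.
move=> k0; have kL := ltn_ord k; pose k' : 'Z_L := inord k.-1.
have k'E : nat_of_ord k' = k.-1 by rewrite inordK // (leq_ltn_trans (leq_pred _) kL).
rewrite (_ : k - 1 = k') //; apply/eqP; rewrite subr_eq; apply/eqP/val_inj.
by rewrite /= k'E modnDmr addn1 prednK // modn_small.
Qed.

Lemma stone_moveP S S' : reflect
  (exists k, [/\ k \in S, k + 1 \notin S & S' = (k + 1) |: (S :\ k)]%SET)
  (stone_move S S').
Proof.
apply: (iffP existsP) => -[k]; first by move=> /and3P[? ? /eqP->]; exists k; rewrite finset.setUC.
by move=> [? ? ->]; exists k; apply/and3P; split=> //; rewrite finset.setUC.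
Qed.

(** A successor determines the stone that moved, as the element of [S] it lacks. *)
Lemma sum_stone_move_r (R : nmodType) S (g : {set 'Z_L} -> R) :
  \sum_(S' | stone_move S S') g S' =
  \sum_(k in S | k + 1 \notin S) g ((k + 1) |: (S :\ k))%SET.
Proof.
pose f k := ((k + 1) |: (S :\ k))%SET.
rewrite (eq_bigl (mem [set f k | k in [set k in S | k + 1 \notin S]]%SET)); last first.
  move=> S'; apply/stone_moveP/imsetP => -[k].
    by move=> [kS k1S ->]; exists k; rewrite // inE kS.
  by rewrite inE => /andP[kS k1S] ->; exists k.
rewrite big_imset /=; first by apply: eq_bigl => k; rewrite inE.
move=> k l; rewrite !inE => /andP[kS _] /andP[_ l1S] /setP/(_ k).
rewrite !inE eqxx eq_sym (negPf (Zp_add1_neq k)) kS /= andbT => /esym/negbT.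
by rewrite negb_or negbK => /andP[_ /eqP].
Qed.

Lemma sum_stone_move_l (R : nmodType) S' (g : {set 'Z_L} -> R) :
  \sum_(S | stone_move S S') g S =
  \sum_(k in (~: S')%SET | k + 1 \in S') g (k |: (S' :\ (k + 1)))%SET.
Proof.
pose f k := (k |: (S' :\ (k + 1)))%SET.
rewrite (eq_bigl (mem [set f k | k in [set k in ~: S' | k + 1 \in S']]%SET)); last first.
  move=> S; apply/stone_moveP/imsetP => -[k].
    move=> [kS k1S S'E]; exists k; rewrite /f S'E.
      by rewrite !inE !eqxx /= orbF andbT eq_sym Zp_add1_neq.
    by rewrite setU1K ?finset.setD1K // !inE negb_and k1S orbT.
  rewrite !inE => /andP[kS k1S] ->; exists k; split.
  - by rewrite setU11.
  - by rewrite !inE eqxx (negPf (Zp_add1_neq k)).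
  - by rewrite /f setU1K ?finset.setD1K // !inE negb_and kS orbT.
rewrite big_imset /=; first by apply: eq_bigl => k; rewrite inE.
move=> k l; rewrite !inE => /andP[kS _] /andP[_ l1S] /setP/(_ k).
rewrite /f !inE eqxx (negPf kS) /= => e.
have /orP[/eqP//|/andP[]//] : (k == l) || (k != l + 1) && false by rewrite -e.
Qed.

Lemma stone_move_card S S' : stone_move S S' -> #|S'| = #|S|.
Proof.
move=> /stone_moveP[k [kS k1S ->]].
by rewrite cardsU1 !inE negb_and k1S orbT (cardsD1 k S) kS.
Qed.

Section eigenvector.
Variable R : realType.
Local Notation psi S := (hole_psi R (~: S)%SET).

(** A stone stepping forward is a hole stepping backward, so [sum_hole_psi_hop] applies to the
    complement with [c = -1]. Predecessors correspond to [c = 1]. *)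
Lemma stone_psi_right S :
  \sum_(S' | stone_move S S') psi S' = growth R L #|~: S|%SET * psi S.
Proof.
rewrite sum_stone_move_r -(sum_hole_psi_hop R L_gt1 (~: S)%SET (or_intror erefl)).
rewrite (reindex_inj (addIr (-1))) /=.
apply: eq_big => h; first by rewrite !inE subrK negbK andbC.
move=> _; congr hole_psi; apply/setP => x; rewrite !inE subrK.
rewrite negb_or negb_and !negbK; case: (eqVneq x (h - 1)) => [->|] //=.
by have := Zp_add1_neq (h - 1); rewrite subrK eq_sym => ->.
Qed.

Lemma stone_psi_left S' :
  \sum_(S | stone_move S S') psi S = growth R L #|~: S'|%SET * psi S'.
Proof.
rewrite sum_stone_move_l -(sum_hole_psi_hop R L_gt1 (~: S')%SET (or_introl erefl)).
apply: eq_big => h; first by rewrite !inE negbK.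
move=> _; congr hole_psi; apply/setP => x; rewrite !inE.
rewrite negb_or negb_and !negbK; case: (eqVneq x (h + 1)) => [->|] //=.
by rewrite Zp_add1_neq.
Qed.

End eigenvector.

Lemma widen_inj n m (mn : (m <= n)%N) : injective (widen_ord mn).
Proof. by move=> x y /(congr1 val) /= /val_inj. Qed.

Lemma card_ord_lt n m : (m <= n)%N -> #|[set x : 'I_n | (x < m)%N]%SET| = m.
Proof.
move=> mn; rewrite -[RHS](card_ord m) -(card_imset _ (@widen_inj _ _ mn)).
apply: eq_card => x; rewrite [LHS]inE; apply/idP/imsetP => [xm|[y _ ->]]; last first.
  exact: (ltn_ord y).
by exists (Ordinal xm) => //; exact: val_inj.
Qed.

(** An element [x] of [S] has all [x] smaller indices in [S] besides itself, so [x < #|S|]; equal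
    cardinalities conclude. *)
Lemma down_closed_eq n (S : {set 'I_n}) :
  (forall x y : 'I_n, x \in S -> (y < x)%N -> y \in S) ->
  S = [set x : 'I_n | (x < #|S|)%N]%SET.
Proof.
move=> dS; apply/eqP; rewrite eqEcard card_ord_lt ?leqnn ?andbT; last first.
  by rewrite -[X in (_ <= X)%N](card_ord n) max_card.
apply/fintype.subsetP => x xS; rewrite inE.
have xn : (x <= n)%N by rewrite ltnW.
rewrite -[X in (X < _)%N](card_ord_lt xn).
apply: proper_card; apply/properP; split; last by exists x; rewrite // inE ltnn.
by apply/fintype.subsetP => y; rewrite inE; exact: dS.
Qed.

(* Moving stones backwards without crossing [0] leads to the packed state. *)
Lemma stone_move_connected (T : Type) (N : nat) (f : {set 'Z_L} -> T) :
  (forall S S', #|S| = N -> stone_move S S' -> f S = f S') ->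
  forall S S', #|S| = N -> #|S'| = N -> f S = f S'.
Proof.
move=> fE; pose S0 : {set 'Z_L} := [set x : 'I__ | (x < N)%N]%SET.
suff fS0 S : #|S| = N -> f S = f S0 by move=> S S' /fS0-> /fS0->.
(* Induction on the sum of positions, which a backward move of a stone away from [0] lowers by
   one. *)
have [m] := ubnP (\sum_(i in S) i)%N; elim: m S => // m IHm S Sm SN.
have [k /and3P[kS k0 k1S]|noS] :=
    pickP [pred k : 'Z_L | [&& k \in S, (0 < k)%N & k - 1 \notin S]].
  pose S' := ((k - 1) |: (S :\ k))%SET.
  have kk : k - 1 != k by rewrite -{2}[k](subrK 1) eq_sym Zp_add1_neq.
  have mv : stone_move S' S.
    apply/stone_moveP; exists (k - 1); rewrite subrK; split.
    - by rewrite setU11.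
    - by rewrite !inE eqxx orbF eq_sym.
    - by rewrite /S' setU1K ?finset.setD1K // !inE negb_and k1S orbT.
  have S'N : #|S'| = N by rewrite -SN (stone_move_card mv).
  rewrite -(fE _ _ S'N mv); apply: IHm => //.
  rewrite -ltnS (leq_trans _ Sm) // ltnS (big_setD1 k kS) big_setU1 /=; last first.
    by rewrite !inE negb_and k1S orbT.
  by have /= -> := Zp_pred k0; rewrite ltn_add2r prednK.
(* No stone can move back without crossing [0], so the occupied positions are closed downwards. *)
congr f; rewrite [LHS](@down_closed_eq _ S) ?SN // => x y xS yx.
have [d] : exists d, x = (y + d)%N :> nat by exists (x - y)%N; rewrite subnKC // ltnW.
elim: d x xS {yx} => [|d IHd] x xS xy.
  by rewrite (_ : y = x) //; apply: val_inj; rewrite /= xy addn0.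
have x0 : (0 < x)%N by rewrite xy addnS.
apply: (IHd (x - 1)); last by rewrite Zp_pred // xy addnS.
by have := noS x; rewrite /= xS x0 /= => /negbFE.
Qed.

End stone_moves.

(** * Spectral radius from a positive eigenvector *)

Section nonneg_spectral_radius.
Context (R : realType) (S : finType) (e : rel S) (v : S -> R) (lam : R).
Local Open Scope complex_scope.
Hypothesis v_gt0 : forall s, 0 < v s.
Hypothesis v_right : forall s, \sum_(s' | e s s') v s' = lam * v s.
Hypothesis v_left : forall s', \sum_(s | e s s') v s = lam * v s'.

(** Eigenvectors are rows, so [v_left] realises [lam]. For any other eigenvalue, the moduli of an
    eigenvector are paired with [v], and [v_right] bounds the eigenvalue by [lam]. *)
Lemma spectral_radius_positive_eigenvector (s0 : S) :
  spectral_radius (transition_matrix R e) = lam.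
Proof.
set A := transition_matrix R e.
have lam0 : 0 <= lam.
  rewrite -(pmulr_lge0 _ (v_gt0 s0)) -v_right; apply: sumr_ge0 => *; exact: ltW.
have lam_eig : eigenvalue A lam%:C.
  apply/eigenvalueP; exists (\row_i (v (enum_val i))%:C).
    apply/rowP => j; rewrite !mxE -rmorphM -v_left rmorph_sum /=.
    rewrite [RHS]big_mkcond [RHS](reindex _ (onW_bij _ (@enum_val_bij S))) /=.
    by apply: eq_bigr => i _; rewrite !mxE; case: (e _ _); rewrite ?mulr1 ?mulr0.
  apply/eqP => /rowP/(_ (enum_rank s0)); rewrite !mxE enum_rankK => /complexI/eqP.
  by rewrite gt_eqF.
have eig_le a : eigenvalue A a -> Normc.normc a <= lam.
  case/eigenvalueP => u uA u0.
  pose w i : R := Normc.normc (u 0 i).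
  have w0 i : 0 <= w i by exact: normc_ge0.
  pose vv (i : 'I_#|S|) := v (enum_val i).
  have W0 : 0 < \sum_i w i * vv i.
    rewrite lt_neqAle eq_sym; apply/andP; split; last first.
      by apply: sumr_ge0 => i _; rewrite mulr_ge0 // ltW // v_gt0.
    apply: contra u0; rewrite psumr_eq0 => [|i _]; last by rewrite mulr_ge0 // ltW // v_gt0.
    move=> /allP uv; apply/eqP/rowP => i; rewrite mxE.
    have := uv i (mem_index_enum _); rewrite /= mulf_eq0 (gt_eqF (v_gt0 _)) orbF.
    by move=> /eqP/Normc.eq0_normc.
  rewrite -(ler_pM2r W0) mulr_sumr.
  have uj j : Normc.normc a * w j <= \sum_(i | e (enum_val i) (enum_val j)) w i.
    rewrite -Normc.normcM.
    have -> : a * u 0 j = (u *m A) 0 j by rewrite uA mxE.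
    rewrite mxE.
    rewrite -lecR -[_%:C]/(`|_ : R[i]|); apply: le_trans (ler_norm_sum _ _ _) _.
    rewrite rmorph_sum /= [X in _ <= X]big_mkcond /=; apply: ler_sum => i _.
    rewrite mxE; case: (e _ _); first by rewrite mulr1.
    by rewrite mulr0 normr0.
  apply: (@le_trans _ _ (\sum_j (\sum_(i | e (enum_val i) (enum_val j)) w i) * vv j)).
    by apply: ler_sum => j _; rewrite mulrA ler_wpM2r // ltW // v_gt0.
  under eq_bigr do rewrite mulr_suml.
  rewrite (exchange_big_dep xpredT) //= mulr_sumr; apply: ler_sum => i _.
  rewrite -mulr_sumr mulrCA ler_wpM2l // -v_right.
  by rewrite [X in _ <= X](reindex _ (onW_bij _ (@enum_val_bij S))).
have ublam : ubound [set Normc.normc a | a in [set a | eigenvalue A a]] lam.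
  by move=> _ [a /= /eig_le ? <-].
have inlam : [set Normc.normc a | a in [set a | eigenvalue A a]] lam.
  by exists lam%:C => //; rewrite /= expr0n addr0 sqrtr_sqr ger0_norm.
apply/eqP; rewrite eq_le; apply/andP; split.
  by apply: ge_sup => //; exists lam.
by apply: ub_le_sup => //; exists lam.
Qed.

End nonneg_spectral_radius.

(** * Determinants of harmonics *)

(** Andreief's form of Cauchy-Binet. Permuting the arguments [x] changes the second determinant by a
    sign, which rebuilds the expansion of the first one; summing over maps rather than subsets
    produces the factorial. *)
Lemma andreief (R : comNzRingType) (T : finType) m (A B : 'I_m -> T -> R) :
  \sum_(x : {ffun 'I_m -> T})
    \det (\matrix_(a, b) A a (x b)) * \det (\matrix_(a, b) B a (x b)) =
  \det (\matrix_(a, b) \sum_t A a t * B b t) *+ m`!.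
Proof.
pose E (x : {ffun 'I_m -> T}) := \prod_a A a (x a).
pose G (x : {ffun 'I_m -> T}) := \det (\matrix_(a, b) B a (x b)).
have detE : \det (\matrix_(a, b) \sum_t A a t * B b t) = \sum_x E x * G x.
  rewrite /determinant.
  transitivity (\sum_(s : 'S_m) \sum_(x : {ffun 'I_m -> T})
      (-1) ^+ s * \prod_a (A a (x a) * B (s a) (x a))).
    apply: eq_bigr => s _; rewrite -mulr_sumr; congr (_ * _).
    under eq_bigr do rewrite mxE.
    by rewrite bigA_distr_bigA.
  rewrite exchange_big; apply: eq_bigr => x _ /=; rewrite /G -det_tr /determinant mulr_sumr.
  apply: eq_bigr => s _; rewrite big_split /= mulrCA; congr (_ * (_ * _)).
  by apply: eq_bigr => a _; rewrite !mxE.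
pose act (p : 'S_m) (x : {ffun 'I_m -> T}) := [ffun a => x (p a)].
have actG (p : 'S_m) x : G (act p x) = (-1) ^+ p * G x.
  have -> : G (act p x) = \det (col_perm p (\matrix_(a, b) B a (x b))).
    by congr (\det _); apply/matrixP => a b; rewrite !mxE ffunE.
  by rewrite col_permE det_mulmx det_perm odd_permV mulrC.
have act_inj p : injective (act p).
  move=> x y /ffunP e; apply/ffunP => a.
  by have := e (p^-1 a)%g; rewrite !ffunE permKV.
transitivity (\sum_(p : 'S_m) \sum_x E x * G x); last first.
  rewrite detE sumr_const (@eq_card _ _ (perm_on [set: 'I_m]%SET)).
    by rewrite card_perm cardsT card_ord.
  by move=> p; rewrite [RHS](_ : _ = true) //; apply/fintype.subsetP => a; rewrite inE.
transitivity (\sum_(p : 'S_m) \sum_x E (act p x) * G (act p x)); last first.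
  by apply: eq_bigr => p _; rewrite [RHS](reindex_inj (act_inj p)).
rewrite exchange_big; apply: eq_bigr => x _ /=.
rewrite {1}/determinant mulr_suml; apply: eq_bigr => p _.
rewrite actG mulrCA mulrA; congr (_ * _ * _).
by rewrite /E; apply: eq_bigr => a _; rewrite mxE ffunE.
Qed.

(** Sylvester's identity: one block matrix is multiplied by the same unipotent matrix on the right
    and on the left. *)
Lemma det_1B_mulmxC (R : comUnitRingType) n m (X : 'M[R]_(n, m)) (Y : 'M[R]_(m, n)) :
  \det (1%:M - X *m Y) = \det (1%:M - Y *m X).
Proof.
have e1 : block_mx 1%:M X Y 1%:M *m block_mx 1%:M 0 (- Y) 1%:M =
    block_mx (1%:M - X *m Y) X 0 1%:M.
  rewrite mulmx_block !mul1mx !mulmx1 !mulmx0 !mulmxN ?mul1mx ?add0r.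
  by congr block_mx; rewrite subrr.
have e2 : block_mx 1%:M 0 (- Y) 1%:M *m block_mx 1%:M X Y 1%:M =
    block_mx 1%:M X 0 (1%:M - Y *m X).
  rewrite mulmx_block !mul1mx !mulmx1 !mul0mx !addr0 mulNmx addrC.
  by rewrite subrr [- _ + _]addrC.
move: (congr1 determinant e1) (congr1 determinant e2).
by rewrite !det_mulmx !det_ublock !det1 mulr1 mul1r mulrC => -> ->.
Qed.

Lemma prod_offdiag (R : comPzSemiRingType) m (f : 'I_m -> 'I_m -> R) :
  (forall a b, f a b = f b a) ->
  (\prod_(a < m) \prod_(b < m | (a < b)%N) f a b) ^+ 2 = \prod_a \prod_(b | b != a) f a b.
Proof.
move=> fC; transitivity
    ((\prod_(a < m) \prod_(b < m | (a < b)%N) f a b) *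
     (\prod_(a < m) \prod_(b < m | (b < a)%N) f a b)).
  rewrite expr2; congr (_ * _); rewrite (exchange_big_dep xpredT) //=.
  by apply: eq_bigr => a _; apply: eq_bigr => b _; rewrite fC.
rewrite -big_split; apply: eq_bigr => a _ /=.
rewrite [RHS](bigID (fun b : 'I_m => (a < b)%N)) /=; congr (_ * _); apply: eq_bigl => b.
  by rewrite -val_eqE /=; case: ltngtP.
by rewrite -val_eqE /=; case: ltngtP.
Qed.

(** * Fourier harmonics and their correlation kernels *)

Section determinantal.
Context (R : realType) (L : nat).
Hypothesis L_gt1 : (1 < L)%N.
Local Notation C := R[i].
Local Open Scope complex_scope.

Definition harmonic (r : int) (k : 'Z_L) : C := fourier_harmonic L R r 0 k.

Lemma harmonicE r k : harmonic r k = cis (- (2 * pi * k%:R * r%:~R / L%:R)).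
Proof. by rewrite /harmonic mxE. Qed.

Lemma harmonicD r (a : nat) k :
  harmonic (r + a%:Z) k = harmonic r k * cis (- (2 * pi / L%:R) *+ a) ^+ k.
Proof.
rewrite !harmonicE -!cisMn -cisD -mulrnA -(mulr_natr (- (2 * pi / L%:R))).
rewrite natrM intrD -pmulrn; congr cis.
by move: (L%:R^-1) (k%:R) (a%:R) => l x y; ring.
Qed.

Lemma harmonicD_zeta r (a : nat) k :
  harmonic (r + a%:Z) k = harmonic r k * zeta R k ^+ a.
Proof. by rewrite harmonicD /zeta -!cisMn -!mulrnA mulnC. Qed.

Lemma normc_harmonic r k : Normc.normc (harmonic r k) = 1.
Proof. by rewrite harmonicE normc_cis. Qed.

Lemma mulc_conj (z : C) : z * z^* = (Normc.normc z ^+ 2)%:C.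
Proof. by rewrite -sqr_normc rmorphXn. Qed.

Lemma normc_prod (I : Type) (s : seq I) (P : pred I) (F : I -> C) :
  Normc.normc (\prod_(i <- s | P i) F i) = \prod_(i <- s | P i) Normc.normc (F i).
Proof. by elim/big_rec2: _ => [|i y x _ <-]; rewrite ?Normc.normc1 ?Normc.normcM. Qed.

(** The matrix is a Vandermonde matrix in the [zeta R (x b)] times a diagonal of phases; [r] enters
    only through the phases. *)
Lemma det_harmonic m r (x : {ffun 'I_m -> 'Z_L}) :
  Normc.normc (\det (\matrix_(a < m, b < m) harmonic (r + a%:Z) (x b))) ^+ 2 =
  \prod_a \prod_(b | b != a) chord R (x a) (x b).
Proof.
rewrite -prod_offdiag => [|a b]; last exact: chord_sym.
congr (_ ^+ 2).
pose v : 'rV[C]_m := \row_b zeta R (x b).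
have -> : (\matrix_(a < m, b < m) harmonic (r + a%:Z) (x b)) =
    Vandermonde m v *m diag_mx (\row_b harmonic r (x b)).
  apply/matrixP => a b; rewrite mul_mx_diag !mxE harmonicD_zeta mulrC //.
rewrite det_mulmx det_Vandermonde det_diag Normc.normcM !normc_prod.
rewrite [X in _ * X]big1 => [|b _]; last by rewrite mxE normc_harmonic.
rewrite mulr1; apply: eq_bigr => a _; rewrite normc_prod; apply: eq_bigr => b _.
by rewrite !mxE chord_sym.
Qed.

Lemma weight_image m (x : {ffun 'I_m -> 'Z_L}) : injective x ->
  weight R (x @: 'I_m) = \prod_a \prod_(b | b != a) chord R (x a) (x b).
Proof.
move=> xinj; rewrite /weight big_imset /=; last by move=> *; exact: xinj.
apply: eq_big => [a|a _]; first by rewrite inE.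
rewrite (_ : (_ :\ _)%SET = x @: [set b | b != a])%SET; last first.
  apply/setP => y; rewrite !inE; apply/andP/imsetP => [[ya /imsetP[b _ yb]]|[b]].
    by exists b; rewrite // inE; apply: contraNneq ya => <-; rewrite yb.
  by rewrite inE => ba ->; rewrite (inj_eq xinj) ba imset_f.
rewrite big_imset /=; last by move=> *; exact: xinj.
by apply: eq_bigl => b; rewrite inE.
Qed.

(** By [andreief], with [det_harmonic] turning the product of determinants into chords. Maps that
    are not injective contribute zero, and each set of size [m] is the image of [m!] injective
    ones. *)
Lemma sum_weight_det m (r : int) (z : 'Z_L -> R) :
  (\sum_(H : {set 'Z_L} | #|H| == m) (\prod_(k in H) z k) * weight R H)%:C =
  \det (\matrix_(a < m, b < m)
    \sum_k (z k)%:C * harmonic (r + a%:Z) k * (harmonic (r + b%:Z) k)^*).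
Proof.
have mN0 : (m`!)%:R != 0 :> C by rewrite pnatr_eq0 -lt0n fact_gt0.
apply: (mulIf mN0); rewrite [RHS]mulr_natr.
rewrite -(andreief (fun a k => (z k)%:C * harmonic (r + a%:Z) k)
  (fun a k => (harmonic (r + a%:Z) k)^*)).
transitivity (\sum_(x : {ffun 'I_m -> 'Z_L})
   ((\prod_a z (x a)) * \prod_a \prod_(b | b != a) chord R (x a) (x b))%:C); last first.
  apply: eq_bigr => x _; rewrite rmorphM -(det_harmonic r) /= -mulc_conj mulrA.
  congr (_ * _).
    have -> : (\matrix_(a < m, b < m) ((z (x b))%:C * harmonic (r + a%:Z) (x b))) =
       (\matrix_(a < m, b < m) harmonic (r + a%:Z) (x b)) *m
       diag_mx (\row_b (z (x b))%:C).
      by apply/matrixP => a b; rewrite mul_mx_diag !mxE mulrC.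
    rewrite det_mulmx det_diag mulrC rmorph_prod; congr (_ * _).
    by apply: eq_bigr => b _; rewrite mxE.
  rewrite -det_map_mx; by congr (\det _); apply/matrixP => a b; rewrite !mxE.
rewrite -rmorph_sum -(rmorph_nat (real_complex R)) -rmorphM; congr (_%:C).
rewrite (bigID (fun x : {ffun 'I_m -> 'Z_L} => injectiveb x)) /=.
rewrite [X in _ = _ + X]big1 ?addr0 => [|x]; last first.
  move=> /injectivePn[a [b ab xab]].
  apply/eqP; rewrite mulf_eq0; apply/orP; right; apply/prodf_eq0; exists a => //.
  by apply/prodf_eq0; exists b; rewrite 1?eq_sym // xab chord_ii.
rewrite (partition_big (fun x : {ffun 'I_m -> 'Z_L} => x @: 'I_m)%SET
   (fun H : {set 'Z_L} => #|H| == m)) /=; last first.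
  by move=> x /injectiveP xinj; rewrite card_imset // card_ord.
rewrite mulr_suml; apply: eq_bigr => H /eqP Hm.
rewrite [RHS](eq_bigr (fun=> (\prod_(k in H) z k) * weight R H)); last first.
  move=> x /andP[/injectiveP xinj /eqP<-]; rewrite weight_image //; congr (_ * _).
  rewrite big_imset /=; last by move=> *; exact: xinj.
  by apply: eq_bigl => a; rewrite inE.
rewrite sumr_const mulr_natr; congr (_ *+ _).
transitivity (#|H| ^_ #|'I_m|)%N; first by rewrite card_ord Hm ffactnn.
rewrite -card_inj_ffuns_on.
apply: eq_card => x; rewrite inE -[RHS]/(injectiveb x && (x @: 'I_m == H)%SET) andbC.
apply: andb_id2l => /injectiveP xinj.
apply/ffun_onP/eqP => [xH|<- a]; last by rewrite imset_f.
apply/eqP; rewrite eqEcard card_imset // card_ord Hm leqnn andbT.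
by apply/fintype.subsetP => _ /imsetP[a _ ->].
Qed.

Lemma cis_ord_neq (a b : nat) : (a < L)%N -> (b < L)%N -> a != b ->
  cis (- (2 * pi / L%:R) *+ a) != cis (- (2 * pi / L%:R) *+ b) :> C.
Proof.
move=> aL bL; apply: contraNneq => e.
have L2 : (Zp_trunc L).+2 = L by rewrite Zp_cast.
have := @zeta_inj R L L_gt1 (inord a) (inord b).
rewrite /zeta !inordK ?L2 // => /(_ e)/(congr1 (@nat_of_ord _)).
by rewrite !inordK ?L2 // => ->.
Qed.

Lemma harmonic_ortho r (a b : nat) : (a < L)%N -> (b < L)%N ->
  \sum_k harmonic (r + a%:Z) k * (harmonic (r + b%:Z) k)^* = L%:R *+ (a == b).
Proof.
move=> aL bL; case: eqVneq => [->|ab].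
  rewrite (eq_bigr (fun=> 1)) => [|k _]; last by rewrite mulc_conj normc_harmonic expr1n.
  by rewrite sumr_const card_ord Zp_cast.
set w := fun m : nat => cis (- (2 * pi / L%:R) *+ m) : C.
have wL m : w m ^+ (Zp_trunc L).+2 = 1 by rewrite Zp_cast // cis_root.
(* The sum is geometric with ratio [g], a root of unity of order dividing [L] and distinct from
   [1]. *)
pose g := w a * (w b)^*.
have g1 : g != 1.
  apply: contraNneq (cis_ord_neq aL bL ab) => gE.
  have wb1 : (w b)^* * w b = 1 by rewrite mulrC mulc_conj normc_cis expr1n.
  apply/eqP; rewrite -[LHS]/(w a) -[RHS]/(w b).
  by rewrite -[w a]mulr1 -wb1 mulrA -/g gE mul1r.
rewrite (eq_bigr (fun k : 'Z_L => g ^+ k)) => [|k _]; last first.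
  rewrite !harmonicD !rmorphM rmorphXn /= mulrACA mulc_conj normc_harmonic expr1n mul1r.
  by rewrite exprMn.
apply/eqP; move: (subrX1 g (Zp_trunc L).+2) => /esym/eqP.
by rewrite exprMn -rmorphXn !wL rmorph1 mulr1 subrr mulf_eq0 subr_eq0 (negPf g1).
Qed.

(** Orthogonality gives the square matrix of all [L] harmonics a right inverse, which is also a left
    inverse. *)
Lemma harmonic_complete r (k l : 'Z_L) :
  \sum_(a < L) harmonic (r + a%:Z) k * (harmonic (r + a%:Z) l)^* = L%:R *+ (k == l).
Proof.
have L2 : (Zp_trunc L).+2 = L by rewrite Zp_cast.
have LN0 : L%:R != 0 :> C by rewrite pnatr_eq0; case: (L) L_gt1.
pose U : 'M[C]_((Zp_trunc L).+2) := \matrix_(a, k) harmonic (r + a%:Z) k.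
pose W : 'M[C]_((Zp_trunc L).+2) := \matrix_(k, a) ((harmonic (r + a%:Z) k)^* / L%:R).
have UW : U *m W = 1%:M.
  apply/matrixP => a b; rewrite !mxE.
  under eq_bigr do rewrite !mxE mulrA.
  rewrite -mulr_suml harmonic_ortho -?[X in (_ < X)%N]L2 //.
  by rewrite -(mulr_natr L%:R) mulrAC divff // mul1r.
have /matrixP/(_ l k) := mulmx1C UW; rewrite !mxE => WU.
rewrite eq_sym -mulr_natr -WU mulr_sumr -[in LHS]L2; apply: eq_bigr => a _.
by rewrite !mxE [_ / _]mulrC -mulrA mulVKf // mulrC.
Qed.

(** The rows of the candidate [Q] lie in the span of [V] and those of [1 - Q] are orthogonal to it,
    so [Q] is the projection. Transposing it puts the conjugate on the second index. *)
Lemma correlation_kernelE N r (k l : 'Z_L) : (N <= L)%N ->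
  correlation_kernel L N R r k l =
  L%:R^-1 * \sum_(a < N) harmonic (r + a%:Z) k * (harmonic (r + a%:Z) l)^*.
Proof.
move=> NL; have LN0 : L%:R != 0 :> C by rewrite pnatr_eq0; case: (L) L_gt1.
set V : 'M[C]_(N, (Zp_trunc L).+2) := \matrix_(a < N) fourier_harmonic L R (r + a%:Z).
have VE a i : V a i = harmonic (r + a%:Z) i by rewrite mxE.
pose V' : 'M[C]_((Zp_trunc L).+2, N) := map_mx Num.conj V^T.
have VV : V *m V' = L%:R%:M.
  apply/matrixP => a b; rewrite !mxE -(@harmonic_ortho r) ?(leq_trans (ltn_ord _)) //.
  by apply: eq_bigr => i _; rewrite [V' i b]mxE [V^T i b]mxE !VE.
pose Q := L%:R^-1 *: (V' *m V).
have QE : proj_ortho V = Q.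
  rewrite -[LHS]mul1mx -[1%:M](subrK Q) mulmxDl.
  rewrite proj_ortho_0 ?proj_ortho_id ?add0r //.
    by rewrite scalemx_sub // submxMl.
  apply/orthomx1P; rewrite mulmxBl mul1mx -scalemxAl -mulmxA VV.
  by rewrite mul_mx_scalar scalerA mulVf // scale1r subrr.
rewrite /correlation_kernel mxE -/V QE mxE [(V' *m V) _ _]mxE; congr (_ * _).
by apply: eq_bigr => a _; rewrite [V' _ _]mxE [V^T _ _]mxE !VE mulrC.
Qed.

(* The event that no empty hole meets the [k a] is a hole probability for the
   [L - N] complementary harmonics; no expansion in minors is needed. *)
Lemma det_correlation_kernel N r n (k : 'I_n -> 'Z_L) : (N <= L)%N -> injective k ->
  \det (\matrix_(a < n, b < n) correlation_kernel L N R r (k a) (k b)) =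
  ((\sum_(H : {set 'Z_L} | #|H| == (L - N)%N)
     (\prod_(i in H) (i \notin [set k a | a : 'I_n]%SET)%:R) * weight R H) / L%:R ^+ (L - N))%:C.
Proof.
move=> NL kinj; set M := (L - N)%N; set J := [set k a | a : 'I_n]%SET.
have LN0 : L%:R != 0 :> C by rewrite pnatr_eq0; case: (L) L_gt1.
pose F (a : 'I_M) i := harmonic (r + N%:Z + a%:Z) i.
pose X : 'M[C]_(n, M) := \matrix_(a, j) (L%:R^-1 * F j (k a)).
pose Y : 'M[C]_(M, n) := \matrix_(j, b) (F j (k b))^*.
have -> : (\matrix_(a < n, b < n) correlation_kernel L N R r (k a) (k b)) = 1%:M - X *m Y.
  apply/matrixP => a b; rewrite mxE correlation_kernelE //.
  rewrite [RHS]mxE [1%:M a b]mxE [(- (X *m Y)) a b]mxE [(X *m Y) a b]mxE.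
  apply/eqP; rewrite -subr_eq0 opprB addrA addrAC; apply/eqP.
  have -> : \sum_j X a j * Y j b =
      L%:R^-1 * \sum_(j < M) harmonic (r + (N + j)%:Z) (k a) *
                             (harmonic (r + (N + j)%:Z) (k b))^*.
    rewrite mulr_sumr; apply: eq_bigr => j _.
    by rewrite !mxE /F PoszD -!addrA !mulrA.
  rewrite addrAC -mulrDr.
  have := harmonic_complete r (k a) (k b).
  have split_ord (f : nat -> C) :
      \sum_(c < L) f c = \sum_(c < N) f c + \sum_(j < M) f (N + j)%N.
    by rewrite -[in LHS](subnKC NL) big_split_ord.
  rewrite (split_ord (fun c => harmonic (r + c%:Z) (k a) * (harmonic (r + c%:Z) (k b))^*)).
  move=> ->.
  by rewrite (inj_eq kinj) -(mulr_natr L%:R) mulrA mulVf // mul1r subrr.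
(* Swapping the factors passes to the [L - N] complementary harmonics: their Gram matrix over the
   points outside [J] is the one in [sum_weight_det]. *)
rewrite det_1B_mulmxC rmorphM fmorphV rmorphXn rmorph_nat /=.
rewrite (sum_weight_det M (r + N%:Z) (fun i => (i \notin J)%:R)).
rewrite -[RHS]mulrC -exprVn -detZ -det_tr; congr (\det _); apply/matrixP => b a.
rewrite [RHS]mxE [RHS]mxE [X in _ = _ * X]mxE [LHS]mxE.
rewrite [1%:M b a]mxE [(- (Y *m X)) b a]mxE [(Y *m X) b a]mxE.
have aL (c : 'I_M) : (c < L)%N by rewrite (leq_trans (ltn_ord c)) ?leq_subr.
have sJ : \sum_(i in J) F a i * (F b i)^* = \sum_c F a (k c) * (F b (k c))^*.
  rewrite big_imset /=; last by move=> *; exact: kinj.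
  by apply: eq_bigl => c; rewrite inE.
have -> : \sum_i (i \notin J)%:R%:C * F a i * (F b i)^* =
    L%:R *+ (a == b) - \sum_c F a (k c) * (F b (k c))^*.
  rewrite -(@harmonic_ortho (r + N%:Z) a b) // [X in _ = X - _](bigID (mem J)) /= sJ.
  rewrite addrAC subrr add0r (bigID (mem J)) /= big1 ?add0r.
    by apply: eq_bigr => i ->; rewrite mul1r.
  by move=> i ->; rewrite !mul0r.
rewrite mulrBr mulrnAr mulVf // mulr_sumr eq_sym; congr (_ - _).
by apply: eq_bigr => c _; rewrite !mxE mulrCA; congr (_ * _); rewrite mulrC.
Qed.

End determinantal.

(** * The measure of maximal entropy *)

(* The identity is a Dirichlet form: the sum of [v s * v s' * (f s - f s') ^ 2]
   over the edges vanishes. *)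
Lemma eigenvector_ratio_edge (R : realFieldType) (S : finType) (e : rel S)
    (v f : S -> R) (lam : R) :
  (forall s, 0 < v s) ->
  (forall s, \sum_(s' | e s s') v s' = lam * v s) ->
  (forall s', \sum_(s | e s s') v s = lam * v s') ->
  (forall s', \sum_(s | e s s') v s * f s = lam * (v s' * f s')) ->
  forall s s', e s s' -> f s = f s'.
Proof.
move=> v0 vr vl vf.
pose D s s' := v s * v s' * (f s - f s') ^+ 2.
have D0 s s' : 0 <= D s s' by rewrite mulr_ge0 ?sqr_ge0 // mulr_ge0 // ltW.
have Dsum : \sum_s \sum_(s' | e s s') D s s' = 0.
  transitivity (\sum_s \sum_(s' | e s s') (v s * f s ^+ 2) * v s' +
     \sum_s \sum_(s' | e s s') ((v s' * f s' ^+ 2) * v s - (v s' * f s') * (v s * f s) *+ 2)).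
    rewrite -big_split; apply: eq_bigr => s _; rewrite -big_split; apply: eq_bigr => s' _ /=.
    by rewrite /D mulr2n; ring.
  rewrite [X in _ + X](exchange_big_dep xpredT) //= -big_split big1 //= => s _.
  rewrite -mulr_sumr vr sumrB -mulr_sumr vl sumrMnl -mulr_sumr vf.
  by rewrite mulr2n; ring.
move=> s s' ess'.
have /eqP := Dsum; rewrite psumr_eq0 => [/allP/(_ s (mem_index_enum _))|t _]; last first.
  by apply: sumr_ge0 => *.
rewrite /= psumr_eq0 // => /allP/(_ s' (mem_index_enum _)); rewrite ess' /=.
by rewrite /D mulf_eq0 gt_eqF ?mulr_gt0 //= sqrf_eq0 subr_eq0 => /eqP.
Qed.

(** * The entropy of the chain and its stationary law *)

Section stationary_law.
Context (R : realType) (L N : nat).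
Hypothesis (L_gt1 : (1 < L)%N) (N_gt0 : (0 < N)%N) (N_lt : (N < L)%N).
Local Notation A := {set 'Z_L}.
Local Notation X := (shift_space A).
Local Notation psi S := (hole_psi R (~: S)%SET).
Local Notation lam := (growth R L N).
Local Notation Omega := (state L N).

Let ZL : #|'Z_L| = L. Proof. by rewrite card_ord Zp_cast. Qed.

Let lam_gt0 : 0 < lam. Proof. by rewrite growth_gt0 ?N_gt0. Qed.

Lemma growth_holes (S : A) : #|S| = N -> growth R L #|~: S|%SET = lam.
Proof. by move=> SN; rewrite cardsCs finset.setCK ZL SN growthC // ltnW. Qed.

Definition packed_state : Omega.
Proof.
exists [set x : 'I_(Zp_trunc L).+2 | (x < N)%N]%SET.
by rewrite card_ord_lt // Zp_cast // ltnW.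
Defined.

Lemma sum_state (g : A -> R) (P : pred A) : (forall S, P S -> #|S| = N) ->
  \sum_(s : Omega | P (val s)) g (val s) = \sum_(S | P S) g S.
Proof.
move=> PN; rewrite [RHS](reindex_onto val (insubd packed_state)) => [|S /PN/eqP SN] /=.
  by apply: eq_bigl => s; rewrite valKd eqxx andbT.
exact: insubdK.
Qed.

Lemma state_psi_right (s : Omega) :
  \sum_(s' : Omega | stone_move (val s) (val s')) psi (val s') = lam * psi (val s).
Proof.
have sN : #|val s| = N by apply/eqP/(valP s).
rewrite (sum_state (fun S => psi S)) => [|S /stone_move_card->//].
by rewrite stone_psi_right // growth_holes.
Qed.

Lemma state_psi_left (s' : Omega) :
  \sum_(s : Omega | stone_move (val s) (val s')) psi (val s) = lam * psi (val s').
Proof.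
have sN : #|val s'| = N by apply/eqP/(valP s').
rewrite (sum_state (fun S => psi S) (P := fun S => stone_move S (val s'))).
  by rewrite stone_psi_left // growth_holes.
by move=> S /stone_move_card <-.
Qed.

Lemma stones_entropyE : stones_entropy L N R = ln lam.
Proof.
rewrite /stones_entropy; congr ln.
apply: (spectral_radius_positive_eigenvector (v := fun s : Omega => psi (val s))).
- by move=> s; exact: hole_psi_gt0.
- exact: state_psi_right.
- exact: state_psi_left.
- exact: packed_state.
Qed.

Lemma trajectories_measurable : measurable (@trajectories L N).
Proof.
pose E (t : int) : set X := [set x : int -> A | #|x t| = N /\ stone_move (x t) (x (t + 1))].
have mE t : measurable (E t).
  have mp := measurable_partition_pair (@coordinate_measurable _ t)
     (@coordinate_measurable 'Z_L (t + 1)).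
  exact: (measurable_partition_preimage
    [set ab : A * A | #|ab.1| = N /\ stone_move ab.1 ab.2] mp).
rewrite (_ : trajectories N = \bigcap_n (E n%:Z `&` E (- n%:Z))).
  by apply: bigcapT_measurable => n; exact: measurableI.
apply/seteqP; split=> x /= Ex; first by move=> n _; split; exact: Ex.
(* A negative time is [- n.+1], hence the index [n.+1]. *)
by move=> [n|n]; have [E1 E2] := Ex n I; have [] := Ex n.+1 I.
Qed.

Section max_entropy.
Variable mu : probability X R.
Hypothesis muN : max_entropy_measure N mu.

Let x0 (x : X) := x 0.
Let step (x : X) := (x 0, x 1).
Local Notation p := (law mu x0).
Local Notation p2 := (law mu step).

Let m0 : measurable_partition x0. Proof. exact: coordinate_measurable. Qed.
Let ms : measurable_partition step. Proof. exact: step_measurable. Qed.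

(** An event of positive mass meets the set of full mass, so properties of trajectories pass to the
    supports of [p] and [p2]. *)
Let traj_mass (B : set X) : measurable B -> 0 < fine (mu B) ->
  exists2 x, B x & trajectories N x.
Proof.
move=> mB Bpos; apply: contrapT => noB.
have [muT _ _] := muN; have mT := trajectories_measurable.
have : (mu B <= mu (~` trajectories N))%E.
  apply: le_measure; rewrite ?inE //; first exact: measurableC.
  by move=> x Bx Tx; apply: noB; exists x.
rewrite probability_setC // muT subee // => B0; move: Bpos.
by rewrite (_ : mu B = 0%E) ?ltxx //; apply/eqP; rewrite eq_le B0 measure_ge0.
Qed.

Lemma step_support a b : 0 < p2 (a, b) -> #|a| = N /\ stone_move a b.
Proof.
move=> /(traj_mass (ms (a, b)))[x [<- <-] /(_ 0)]; by rewrite add0r.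
Qed.

Lemma state_support a : 0 < p a -> #|a| = N.
Proof. by move=> /(traj_mass (m0 a))[x <- /(_ 0)[]]. Qed.

Lemma step_fst a : \sum_b p2 (a, b) = p a.
Proof.
rewrite -[x0]/(fst \o step) law_comp //.
rewrite (reindex_onto (fun b => (a, b)) snd) => [|[c b] /= /eqP-> //].
by apply: eq_bigl => b; rewrite /= !eqxx.
Qed.

Lemma law_step_snd : law mu (snd \o step) = p.
Proof.
have [_ imu _] := muN; rewrite -(law_iter_shift 1 imu m0); congr law.
Qed.

Lemma step_snd b : \sum_a p2 (a, b) = p b.
Proof.
rewrite -law_step_snd law_comp //.
rewrite [RHS](reindex_onto (fun a => (a, b)) fst) => [|[a c] /= /eqP-> //].
by apply: eq_bigl => a; rewrite /= !eqxx.
Qed.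

Lemma step_expect_fst (g : A -> R) : \sum_ab p2 ab * g ab.1 = \sum_a p a * g a.
Proof. by rewrite -[x0]/(fst \o step) law_comp_expect. Qed.

Lemma step_expect_snd (g : A -> R) : \sum_ab p2 ab * g ab.2 = \sum_a p a * g a.
Proof. by rewrite -law_step_snd law_comp_expect. Qed.

Let p2_le a b : p2 (a, b) <= p a.
Proof. by rewrite -step_fst (bigD1 b) //= lerDl sumr_ge0 // => *; exact: law_ge0. Qed.

(** The Doob transform of the move relation by [psi]. The cardinality test is there because the
    eigenvalue is [lam] on sets of size [N], while the kernel lives on all subsets. *)
Definition parry (a b : A) : R :=
  if (#|a| == N) && stone_move a b then psi b / (lam * psi a) else 0.

Let den_gt0 (a : A) : 0 < lam * psi a.
Proof. exact: mulr_gt0 lam_gt0 (hole_psi_gt0 _ _ _). Qed.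

Lemma parry_gt0 (a b : A) : #|a| = N -> stone_move a b -> 0 < parry a b.
Proof. by move=> aN ab; rewrite /parry aN eqxx ab divr_gt0 ?hole_psi_gt0 ?den_gt0. Qed.

Lemma parry_ge0 a b : 0 <= parry a b.
Proof.
have [/andP[/eqP aN ab]|] := boolP ((#|a| == N) && stone_move a b).
  exact/ltW/parry_gt0.
by rewrite /parry => /negPf->.
Qed.

Lemma parry_sum_le1 a : \sum_b parry a b <= 1.
Proof.
rewrite -big_mkcond /=; have [aN|_] := eqVneq #|a| N; last by rewrite big_pred0.
rewrite -mulr_suml stone_psi_right // growth_holes // divff //.
by rewrite gt_eqF // den_gt0.
Qed.

(* Entropy [ln lam] leaves no defect in Gibbs' inequality for the law of two
   consecutive states against the Parry kernel, which forces equality. *)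
Lemma step_parry a b : p2 (a, b) = p a * parry a b.
Proof.
have [_ imu ks] := muN.
(* The conditional law of the next state; where [p a = 0], division by zero makes the row vanish,
   which is still sub-stochastic. *)
pose Q a b := p2 (a, b) / p a.
have Q0 c d : 0 <= Q c d by rewrite divr_ge0 ?law_ge0.
have Q1 c : \sum_d Q c d <= 1.
  rewrite -mulr_suml step_fst.
  by have [->|pc] := eqVneq (p c) 0; rewrite ?mul0r // divff.
have Qpos (x : X) : 0 < p2 (step x) -> 0 < Q (x 0) (x 1).
  by move=> px; rewrite divr_gt0 // (lt_le_trans px) // p2_le.
have := ks_entropy_le_cost imu Q0 Q1 Qpos.
rewrite ks stones_entropyE lee_fin => lnlam.
have P0 (ab : A * A) : 0 <= p ab.1 * parry ab.1 ab.2.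
  by rewrite mulr_ge0 ?law_ge0 ?parry_ge0.
have p2pos (ab : A * A) : 0 < p2 ab -> [/\ 0 < p ab.1, #|ab.1| = N & stone_move ab.1 ab.2].
  case: ab => c d /= pcd; have [cN cd] := step_support pcd; split=> //.
  exact: lt_le_trans pcd (p2_le _ _).
have parry_pos (ab : A * A) : 0 < p2 ab -> 0 < parry ab.1 ab.2.
  by move=> /p2pos[_ cN cd]; exact: parry_gt0.
have Ppos (ab : A * A) : 0 < p2 ab -> 0 < p ab.1 * parry ab.1 ab.2.
  by move=> h; rewrite mulr_gt0 ?parry_pos //; case: (p2pos _ h).
have := @gibbs_sum_leif R _ p2 (fun ab => p ab.1 * parry ab.1 ab.2)
   (law_ge0 mu step) P0 Ppos.
have Psum : \sum_(ab : A * A) p ab.1 * parry ab.1 ab.2 <= 1.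
  rewrite -(pair_bigA _ (fun a b => p a * parry a b)) /= -(law_sum1 mu m0).
  by apply: ler_sum => c _; rewrite -mulr_sumr ler_piMr ?law_ge0 ?parry_sum_le1.
rewrite law_sum1 //.
(* Up to a difference of [ln psi] terms, whose mean vanishes by stationarity, this is the cost of
   [Q] minus [ln lam], nonnegative by the entropy bound. *)
have cost0 : 0 <= \sum_(ab : A * A) p2 ab * ln (p ab.1 * parry ab.1 ab.2) -
                 \sum_ab p2 ab * ln (p2 ab).
  have -> : \sum_(ab : A * A) p2 ab * ln (p ab.1 * parry ab.1 ab.2) -
            \sum_ab p2 ab * ln (p2 ab) =
     \sum_(ab : A * A) p2 ab * (- ln (Q ab.1 ab.2)) - \sum_ab p2 ab * ln lam +
     (\sum_ab p2 ab * ln (psi ab.2) - \sum_ab p2 ab * ln (psi ab.1)).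
    rewrite -!sumrB -big_split; apply: eq_bigr => -[c d] _ /=.
    have := law_ge0 mu step (c, d); rewrite le_eqVlt => /predU1P[<-|pcd].
      by rewrite !mul0r !subrr addr0.
    have [pc cN cd] := p2pos _ pcd; have Pcd := parry_pos _ pcd.
    rewrite lnM ?posrE // ln_div ?posrE //.
    rewrite /parry cN eqxx cd /= ln_div ?posrE ?den_gt0 ?hole_psi_gt0 //.
    rewrite lnM ?posrE ?hole_psi_gt0 //.
    move: (ln _) (ln _) (ln _) (ln _) (ln _) => l1 l2 l3 l4 l5; ring.
  rewrite (step_expect_snd (fun a => ln (psi a))) (step_expect_fst (fun a => ln (psi a))).
  by rewrite subrr addr0 -mulr_suml law_sum1 // mul1r subr_ge0.
case=> gle geq.
have : [forall ab, p2 ab == p ab.1 * parry ab.1 ab.2].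
  by rewrite -geq eq_le gle /= (le_trans _ cost0) // subr_le0.
by move=> /forallP/(_ (a, b))/eqP.
Qed.

(** With [f] the ratio, [psi * f] equals [p / psi], and stationarity of [p] under [parry] makes it a
    left eigenvector for [lam]. Then [eigenvector_ratio_edge] makes [f] constant along moves, and
    connectivity does the rest. *)
Lemma state_law_ratio (a b : A) : #|a| = N -> #|b| = N ->
  p a / weight R (~: a)%SET = p b / weight R (~: b)%SET.
Proof.
pose f (a : A) : R := p a / weight R (~: a)%SET.
apply: (stone_move_connected (f := f)) => S S' SN SS'.
have S'N : #|S'| = N by rewrite (stone_move_card SS').
have psi0 (c : A) : psi c != 0 by rewrite gt_eqF // hole_psi_gt0.
pose s : Omega := exist _ S (introT eqP SN).
pose s' : Omega := exist _ S' (introT eqP S'N).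
apply: (@eigenvector_ratio_edge R Omega (fun s s' => stone_move (val s) (val s'))
   (fun s => psi (val s)) (fun s => f (val s)) lam _ state_psi_right state_psi_left _ s s') => //.
  by move=> t; exact: hole_psi_gt0.
move=> t; have tN : #|val t| = N by apply/eqP/(valP t).
have fE (c : A) : psi c * f c = p c / psi c.
  have w2 : weight R (~: c)%SET = psi c * psi c by rewrite -[RHS]expr2 sqr_hole_psi.
  by rewrite /f w2 invfM mulrCA mulVKf.
rewrite (sum_state (fun S => psi S * f S) (P := fun S => stone_move S (val t))); last first.
  by move=> c /stone_move_card <-.
rewrite fE -step_snd mulr_suml mulr_sumr [LHS]big_mkcond; apply: eq_bigr => c _.
rewrite step_parry /parry; case: ifP => [ct|]; last by rewrite andbF mulr0 mul0r mulr0.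
rewrite -(stone_move_card ct) tN eqxx fE /=.
by field; rewrite !psi0 gt_eqF.
Qed.

Lemma marginal_determinantal (r0 : int) (n : nat) (k : 'I_n -> 'Z_L) : injective k ->
  (fine (mu [set x : X | [set k a | a : 'I_n]%SET \subset x 0]))%:C%C
    = \det (\matrix_(a < n, b < n) correlation_kernel L N R r0 (k a) (k b)).
Proof.
pose c := p (val packed_state) / weight R (~: val packed_state)%SET.
have pE (S : A) : p S = (#|S| == N)%:R * (c * weight R (~: S)%SET).
  have [SN|SN] := eqVneq #|S| N; last first.
    rewrite mul0r; apply/eqP; rewrite eq_le law_ge0 andbT leNgt.
    by apply: contra SN => /state_support->.
  have pN : #|val packed_state| = N by apply/eqP/(valP packed_state).
  by rewrite mul1r /c (state_law_ratio pN SN) divfK // gt_eqF // weight_gt0.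
have sumE (P : pred A) : \sum_(S | P S) p S =
    c * \sum_(H : A | (#|H| == (L - N)%N) && P (~: H)%SET) weight R H.
  rewrite mulr_sumr [RHS](reindex_inj (inv_inj (@finset.setCK _))) /=.
  rewrite [LHS]big_mkcond [RHS]big_mkcond; apply: eq_bigr => S _.
  rewrite finset.setCK pE cardsCs ZL.
  have SL : (#|~: S|%SET <= L)%N by rewrite (leq_trans (max_card _)) // ZL.
  rewrite [(_ == N)](_ : _ = (#|~: S|%SET == (L - N)%N)); last by apply/eqP/eqP; lia.
  by case: (P S); case: eqP => //=; rewrite ?mul1r ?mul0r.
have keyE (J : A) : \sum_(H : A | (#|H| == (L - N)%N) && (J \subset ~: H)%SET) weight R H =
    \sum_(H : A | #|H| == (L - N)%N) (\prod_(i in H) (i \notin J)%:R) * weight R H.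
  rewrite big_mkcondr; apply: eq_bigr => H _; case: ifPn => [JH|JH].
    rewrite big1 ?mul1r // => i iH.
    suff -> : i \notin J by [].
    by apply: contraL iH => /(fintype.subsetP JH); rewrite inE.
  have [i iJ iH] : exists2 i, i \in J & i \in H.
    by move/subsetPn: JH => [i iJ]; rewrite inE negbK => iH; exists i.
  by rewrite (bigD1 i) //= iJ !mul0r.
(* The determinant formula for no points at all, where the determinant is [1], evaluates the total
   weight and hence the constant [c]. *)
have norm1 : c = (L%:R ^+ (L - N))^-1.
  have LN0 : L%:R != 0 :> R by rewrite pnatr_eq0 -lt0n (ltn_trans _ L_gt1).
  have inj0 : injective (fun _ : 'I_0 => 0 : 'Z_L) by case.
  have := det_correlation_kernel R L_gt1 r0 (ltnW N_lt) inj0.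
  rewrite det_mx00 -keyE (_ : [set 0 | _ : 'I_0]%SET = finset.set0); last first.
    by apply/setP => i; rewrite inE; apply/imsetP => -[[]].
  move=> /(congr1 (@complex.Re R)) /= W1.
  have := sumE xpredT; rewrite law_sum1 // => cW.
  apply: (mulIf (expf_neq0 (L - N) LN0)); rewrite mulVf ?expf_neq0 //.
  have <- : \sum_(H : A | (#|H| == (L - N)%N) && (finset.set0 \subset ~: H)%SET) weight R H
     = L%:R ^+ (L - N).
    by apply: (mulIf (invr_neq0 (expf_neq0 (L - N) LN0))); rewrite -W1 divff ?expf_neq0.
  rewrite [RHS]cW; congr (_ * _); apply: eq_bigl => H; by rewrite finset.sub0set.
move=> kinj; rewrite det_correlation_kernel // 1?ltnW //; congr (_%:C)%C.
rewrite -keyE mulrC -norm1 -(sumE (fun S => [set k a | a : 'I_n]%SET \subset S)).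
by rewrite -(prob_preimage mu _ m0).
Qed.

End max_entropy.
End stationary_law.

Theorem theorem2 (R : realType) (L N : nat)
    (hL : (2 <= L)%N) (hN1 : (1 <= N)%N) (hNL : (N <= L - 1)%N) :
  stones_entropy L N R
    = ln (sin (pi * N%:R / L%:R) / sin (pi / L%:R))
  /\
  forall mu : probability (shift_space {set 'Z_L}) R,
    max_entropy_measure N mu ->
  forall (r0 : int) (n : nat) (k : 'I_n -> 'Z_L), injective k ->
    (fine (mu [set x : int -> {set 'Z_L} | [set k a | a : 'I_n]%SET \subset x 0]))%:C%C
      = \det (\matrix_(a < n, b < n) correlation_kernel L N R r0 (k a) (k b)).
Proof.
have N_lt : (N < L)%N by lia.
split; first exact: stones_entropyE.
by move=> mu hmu r0 n k; exact: marginal_determinantal.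
Qed.
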